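(* Let $H \leq S_n$ be a permutation group given by a generating set $X$. Then the finest disjoint direct product decomposition of $H$ can be computed in time polynomial in $n\cdot |X|$.
   Context: The input is $n$ and a set $X \subseteq S_n$ of permutations of $\{1,\dots,n\}$, and $H=\langle X\rangle$. For a permutation group $G$, $\mathrm{Supp}(G)$ is the set of points moved by some element of $G$. $H = H_1 \times H_2 \times \cdots \times H_r$ is a disjoint direct product decomposition of $H$ if it is a direct product decomposition of $H$ (into subgroups $H_i\leq H$) and the groups $H_i$ have pairwise disjoint supports; each $H_i$ fixes all points outside $\mathrm{Supp}(H_i)$. Convention: if $r>1$, all factors $H_i$ are nontrivial. $H$ is d.d.p. decomposable if it has a disjoint direct product decomposition with $r>1$, and d.d.p. indecomposable otherwise. A disjoint direct product decomposition is finest if each of its factors is d.d.p. indecomposable. Such a decomposition is unique up to the order of factors. The support of each factor of a decomposition is a union of $H$-orbits, and a decomposition is specified as output by the corresponding partition $\{C_1,\dots,C_r\}$ of the set of $H$-orbits of size greater than $1$: the $i$-th factor is the restriction of $H$ to the union of the orbits in $C_i$. *)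

(* Defs.v *)
From HB Require Import structures.
From mathcomp Require Import all_boot all_order all_algebra all_fingroup.

Set Implicit Arguments.
Unset Strict Implicit.
Unset Printing Implicit Defensive.

(** Machine model: a random access machine with unit cost, given by structured
    programs.  The machine has an input tape, an output tape, registers that a
    program names directly, and an indirectly addressed memory, all holding
    natural numbers.  The only arithmetic is addition and truncated
    subtraction, so the bit length of a register grows by at most one per
    step; this is what makes the unit-cost measure polynomially related to
    Turing machine time (Cook and Reckhow 1973). *)

Inductive prog : Type :=
| Skip
| Const (d k : nat)       (* R[d] := k *)
| Add (d a b : nat)       (* R[d] := R[a] + R[b] *)
| Sub (d a b : nat)       (* R[d] := R[a] - R[b], truncated at 0 *)
| Fetch (d a : nat)       (* R[d] := M[R[a]] *)
| Store (a b : nat)       (* M[R[a]] := R[b] *)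
| Read (d : nat)          (* R[d] := next input number, 0 past the end *)
| Write (a : nat)         (* append R[a] to the output *)
| Seq (c1 c2 : prog)
| If (a : nat) (c1 c2 : prog)  (* if R[a] <> 0 then c1 else c2 *)
| While (a : nat) (c : prog).  (* while R[a] <> 0 do c *)

Record state : Type := State {
  reg : nat -> nat;
  mem : nat -> nat;
  inp : seq nat;
  out : seq nat
}.

Definition upd (f : nat -> nat) (i v : nat) : nat -> nat :=
  fun j => if j == i then v else f j.

Definition set_reg (s : state) (d v : nat) : state :=
  State (upd (reg s) d v) (mem s) (inp s) (out s).

(** [exec c s t s']: started in [s], the program [c] halts in [s'] after
    exactly [t] steps; every elementary instruction and every test of a
    register is one step. *)
Inductive exec : prog -> state -> nat -> state -> Prop :=
| ExecSkip s : exec Skip s 1 s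
| ExecConst s d k : exec (Const d k) s 1 (set_reg s d k)
| ExecAdd s d a b : exec (Add d a b) s 1 (set_reg s d (reg s a + reg s b))
| ExecSub s d a b : exec (Sub d a b) s 1 (set_reg s d (reg s a - reg s b))
| ExecFetch s d a : exec (Fetch d a) s 1 (set_reg s d (mem s (reg s a)))
| ExecStore s a b :
    exec (Store a b) s 1
      (State (reg s) (upd (mem s) (reg s a) (reg s b)) (inp s) (out s))
| ExecRead s d :
    exec (Read d) s 1
      (State (upd (reg s) d (head 0 (inp s))) (mem s) (behead (inp s)) (out s))
| ExecWrite s a :
    exec (Write a) s 1 (State (reg s) (mem s) (inp s) (rcons (out s) (reg s a)))
| ExecSeq c1 c2 s1 s2 s3 t1 t2 :
    exec c1 s1 t1 s2 -> exec c2 s2 t2 s3 -> exec (Seq c1 c2) s1 (t1 + t2) s3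
| ExecIfTrue a c1 c2 s s' t :
    reg s a != 0 -> exec c1 s t s' -> exec (If a c1 c2) s t.+1 s'
| ExecIfFalse a c1 c2 s s' t :
    reg s a == 0 -> exec c2 s t s' -> exec (If a c1 c2) s t.+1 s'
| ExecWhileTrue a c s1 s2 s3 t1 t2 :
    reg s1 a != 0 -> exec c s1 t1 s2 -> exec (While a c) s2 t2 s3 ->
    exec (While a c) s1 (t1 + t2).+1 s3
| ExecWhileFalse a c s :
    reg s a == 0 -> exec (While a c) s 1 s.

Definition init (w : seq nat) : state :=
  State (fun _ => 0) (fun _ => 0) w [::].

Definition computes_in (c : prog) (w : seq nat) (t : nat) (v : seq nat) : Prop :=
  exists2 s : state, exec c (init w) t s & out s = v.

Definition encode_seq (T : Type) (enc : T -> seq nat) (s : seq T) : seq nat :=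
  size s :: flatten [seq enc x | x <- s].

(** The points 1, ..., n are represented by 0, ..., n - 1, and a permutation by
    its n images; the input is n, the number of generators, then the
    generators. *)
Definition encode_perm (n : nat) (g : 'S_n) : seq nat :=
  [seq val (g i) | i <- enum 'I_n].

Definition encode_input (n : nat) (gens : seq 'S_n) : seq nat :=
  n :: encode_seq (@encode_perm n) gens.

Definition encode_orbit (n : nat) (O : {set 'I_n}) : seq nat :=
  encode_seq (fun x : 'I_n => [:: val x]) (enum O).

Definition encode_output (n : nat) (Cs : seq (seq {set 'I_n})) : seq nat :=
  encode_seq (encode_seq (@encode_orbit n)) Cs.

Definition psupp (n : nat) (G : {set 'S_n}) : {set 'I_n} :=
  [set x | [exists g in G, g x != x]].

(** The case [Ks = [::]] is the empty product; it occurs only for [H = 1]. *)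
Definition ddp_decomposition (n : nat) (H : {group 'S_n})
    (Ks : seq {group 'S_n}) : Prop :=
  [/\ \big[dprod/1%g]_(K <- Ks) K = H,
      pairwise (fun K L : {group 'S_n} => [disjoint psupp K & psupp L]) Ks
    & 1 < size Ks -> forall K : {group 'S_n}, K \in Ks -> K :!=: 1%g].

Definition ddp_decomposable (n : nat) (H : {group 'S_n}) : Prop :=
  exists2 Ks : seq {group 'S_n}, ddp_decomposition H Ks & 1 < size Ks.

Definition finest_ddp_decomposition (n : nat) (H : {group 'S_n})
    (Ks : seq {group 'S_n}) : Prop :=
  ddp_decomposition H Ks /\
  forall K : {group 'S_n}, K \in Ks -> ~ ddp_decomposable K.

Definition moved_orbits (n : nat) (H : {group 'S_n}) : {set {set 'I_n}} :=
  [set O in [set orbit 'P H x | x : 'I_n] | 1 < #|O|].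

(** [Cs] lists, without repetition and in some order, the blocks of a partition
    of [moved_orbits H], each block being itself given as a list of orbits. *)
Definition lists_orbit_partition (n : nat) (H : {group 'S_n})
    (Cs : seq (seq {set 'I_n})) : Prop :=
  [/\ uniq (flatten Cs), flatten Cs =i moved_orbits H & [::] \notin Cs].

(** [restr_perm D] is defined on the setwise stabiliser of [D], which contains
    all of [H] when [D] is a union of [H]-orbits. *)
Definition restriction (n : nat) (H : {group 'S_n}) (D : {set 'I_n}) :
    {group 'S_n} :=
  (restr_perm D @* H)%G.

Definition factors (n : nat) (H : {group 'S_n}) (Cs : seq (seq {set 'I_n})) :
    seq {group 'S_n} :=
  [seq restriction H (\bigcup_(O <- C) O) | C <- Cs].

(* Main.v *)
Require Import Defs.
From HB Require Import structures.
From mathcomp Require Import all_boot all_order all_algebra all_fingroup.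
From mathcomp Require Import zify.

Set Implicit Arguments.
Unset Strict Implicit.
Unset Printing Implicit Defensive.

(** Call a union [E] of [H]-orbits inside a union [D] of [H]-orbits separable
    when the restriction of [H] to [D] is the product of its restrictions to
    [E] and to [D :\: E].  Separable sets form a Boolean algebra, and the finest
    decomposition of [H] is given by its atoms for [D] the support of [H].  The
    orbits are added to [D] one at a time: the atoms that remain separable in
    [D] extended by a new orbit [O] are atoms again, and all others merge with
    [O] into a single atom.  An atom [C] remains separable if and only if the
    restriction to [C] of every generator lies in the restriction of [H] to
    the new [D], and this is a membership test in a permutation group, answered
    by sifting through a table of coset representatives that has been closed
    under products (Sims; Furst, Hopcroft and Luks).

    Running time is obtained once and for all from an intermediate language
    whose values are all bounded by the sum of the degree and the number of
    generators (plus one): every loop of it makes a bounded number of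
    iterations, so every program of it runs in polynomial time. *)

(** * A loop language that compiles to random access machines *)

(** The obstacle is that there may be exponentially many unions of orbits, so separability cannot be
    tested on all of them. Adding a single orbit [O] leaves only the current atoms to test, at most
    [n] of them. The failing atoms need no further search: a nonempty separable part of their union
    with [O] that misses [O] would contain a whole failing atom, which would then be separable in
    the extended set after all; a part that meets [O] contains it, and its complement misses [O].
    Inserting the generators into the table is not enough: sifting is known to decide membership
    only once all pairwise products of entries sift. An insertion never replaces an entry, so the
    [n ^ 2] places of the table bound the number of rounds. A bound in [n * m] rather than [n + m]
    is possible because [n + m <= n * m + 1] for positive [n] and [m]; if one of them is zero, the
    group is trivial and the answer is written in constant time. *)

Inductive expr : Type :=
| EBool (b : bool)
| EPoints
| EGens
| EGet (a : nat) (i j k : expr)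
| EEq (e f : expr)
| ESucc (e : expr).

Inductive stmt : Type :=
| SSkip
| SSet (a : nat) (i j k e : expr)
| SRead (a : nat) (i j k : expr)
| SWrite (e : expr)
| SSeq (c1 c2 : stmt)
| SIf (e : expr) (c1 c2 : stmt)
| SFor (a : nat) (e : expr) (c : stmt).

(** Memory is addressed by an array name and three indices, as many as a table of permutations
    needs: level, image of the base point, argument. *)
Record lstate : Type := LState {
  lmem : nat -> nat -> nat -> nat -> nat;
  linp : seq nat;
  lout : seq nat
}.

Definition lupd (f : nat -> nat -> nat -> nat -> nat) a i j k v :=
  fun a' i' j' k' =>
    if [&& a' == a, i' == i, j' == j & k' == k] then v else f a' i' j' k'.

Definition lset (s : lstate) a i j k v : lstate :=
  LState (lupd (lmem s) a i j k v) (linp s) (lout s).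

(** The slack of two keeps the truth value 1 below the radix even when [n] and [m] vanish. *)
Definition radix (n m : nat) := (n + m).+2.

(** [ESucc] and [SRead] are clamped so that every value stays below the radix;
    this bounds the number of iterations of every loop. *)
Fixpoint eval (n m : nat) (s : lstate) (e : expr) : nat :=
  match e with
  | EBool b => b
  | EPoints => n
  | EGens => m
  | EGet a i j k => lmem s a (eval n m s i) (eval n m s j) (eval n m s k)
  | EEq e f => eval n m s e == eval n m s f
  | ESucc e => let v := eval n m s e in if v.+1 < radix n m then v.+1 else v
  end.

Fixpoint sem (n m : nat) (c : stmt) (s : lstate) : lstate :=
  match c with
  | SSkip => s
  | SSet a i j k e =>
      lset s a (eval n m s i) (eval n m s j) (eval n m s k) (eval n m s e)
  | SRead a i j k =>
      let v := head 0 (linp s) in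
      LState (lupd (lmem s) a (eval n m s i) (eval n m s j) (eval n m s k)
                (if v < radix n m then v else 0))
        (behead (linp s)) (lout s)
  | SWrite e => LState (lmem s) (linp s) (rcons (lout s) (eval n m s e))
  | SSeq c1 c2 => sem n m c2 (sem n m c1 s)
  | SIf e c1 c2 => if eval n m s e != 0 then sem n m c1 s else sem n m c2 s
  | SFor a e c =>
      foldl (fun s i => sem n m c (lset s a 0 0 0 i)) s (iota 0 (eval n m s e))
  end.

Definition lbounded (n m : nat) (s : lstate) : Prop :=
  forall a i j k, lmem s a i j k < radix n m.

(** * Polynomial bounds with natural coefficients *)

Definition poly_bounded (f : nat -> nat) : Prop :=
  exists p : {poly nat}, forall x, f x <= (p.[x])%R.

Lemma poly_bounded_cst k : poly_bounded (fun=> k).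
Proof. by exists (k%:P)%R => x; rewrite hornerC. Qed.

Lemma poly_bounded_id : poly_bounded id.
Proof. by exists ('X)%R => x; rewrite hornerX. Qed.

Lemma poly_boundedD f g :
  poly_bounded f -> poly_bounded g -> poly_bounded (fun x => f x + g x).
Proof.
by move=> [p hp] [q hq]; exists (p + q)%R => x; rewrite hornerD leq_add.
Qed.

Lemma poly_boundedM f g :
  poly_bounded f -> poly_bounded g -> poly_bounded (fun x => f x * g x).
Proof.
by move=> [p hp] [q hq]; exists (p * q)%R => x; rewrite hornerM leq_mul.
Qed.

Ltac poly_bound := repeat first
  [ assumption | apply: poly_bounded_cst | apply: poly_bounded_id
  | apply: poly_boundedD | apply: poly_boundedM ].

(** Transfers a bound in the radix to a bound in [n * m]. *)
Lemma horner_nat_mono (p : {poly nat}) x y : x <= y -> ((p.[x])%R <= (p.[y])%R).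
Proof.
move=> xy; elim/poly_ind: p => [|p c IH]; first by rewrite !horner0.
by rewrite !hornerMXaddC; apply: leq_add => //; apply: leq_mul.
Qed.

(** * Total correctness of machine programs with a time bound *)

(** An upper bound in place of the exact time lets branches of different cost share one
    specification. *)
Definition halts (P : prog) (s : state) (T : nat) (Q : state -> Prop) : Prop :=
  exists t s', [/\ exec P s t s', t <= T & Q s'].

Lemma haltsW P s T T' (Q Q' : state -> Prop) :
  halts P s T Q -> T <= T' -> (forall s', Q s' -> Q' s') -> halts P s T' Q'.
Proof.
move=> [t [s' [e tT q]]] TT' QQ'; exists t, s'.
by split=> //; [exact: leq_trans TT' | exact: QQ'].
Qed.

Lemma halts_seq P1 P2 s T1 T2 (Q : state -> Prop) :
  halts P1 s T1 (fun s' => halts P2 s' T2 Q) -> halts (Seq P1 P2) s (T1 + T2) Q.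
Proof.
move=> [t1 [s1 [e1 le1 [t2 [s2 [e2 le2 q]]]]]].
exists (t1 + t2), s2; split=> //; first exact: ExecSeq e1 e2.
exact: leq_add.
Qed.

Lemma halts_if a P1 P2 s T (Q : state -> Prop) :
  (reg s a != 0 -> halts P1 s T Q) -> (reg s a == 0 -> halts P2 s T Q) ->
  halts (If a P1 P2) s T.+1 Q.
Proof.
move=> h1 h2; case: (boolP (reg s a == 0)) => r0.
- have [t [s' [e le q]]] := h2 r0.
  by exists t.+1, s'; split=> //; exact: ExecIfFalse.
- have [t [s' [e le q]]] := h1 r0.
  by exists t.+1, s'; split=> //; exact: ExecIfTrue.
Qed.

(** The tested register counts down from [k], so the invariant itself fixes the number of
    iterations. Each costs one test besides the body, and the last test, which fails, is the final
    successor. *)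
Lemma halts_while a P s T k (I : nat -> state -> Prop) :
  I 0 s -> (forall i s, i <= k -> I i s -> reg s a = k - i) ->
  (forall i s, i < k -> I i s -> halts P s T (I i.+1)) ->
  halts (While a P) s (k * T.+1).+1 (I k).
Proof.
move=> I0 hr hP.
suff H r : forall i s, i + r = k -> I i s ->
    halts (While a P) s (r * T.+1).+1 (I k) by exact: H I0.
elim: r => [|r IH] i {I0}s ir Ii.
  rewrite addn0 in ir; subst i.
  by exists 1, s; split=> //; apply: ExecWhileFalse; rewrite (hr k) ?subnn.
have ik : i < k by rewrite -ir -addSnnS leq_addr.
have [t1 [s1 [e1 le1 I1]]] := hP _ _ ik Ii.
have [t2 [s2 [e2 le2 I2]]] := IH i.+1 s1 (etrans (addSnnS _ _) ir) I1.
exists (t1 + t2).+1, s2; split=> //.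
  by apply: ExecWhileTrue e1 e2; rewrite (hr i) ?(ltnW ik) // -lt0n subn_gt0.
by rewrite mulSn; lia.
Qed.

Lemma halts_step P s s' (Q : state -> Prop) :
  exec P s 1 s' -> Q s' -> halts P s 1 Q.
Proof. by exists 1, s'. Qed.

Ltac step := first
  [ apply: halts_step; [by constructor|]
  | apply: halts_seq; apply: halts_step; [by constructor|] ].

Ltac regs := rewrite /= /upd /=; repeat (case: eqP => [?|?]); lia.

(** * Compilation of expressions and statements *)

(** Registers are used as a stack: code compiled at depth [d] may overwrite the registers from [d]
    on and must preserve those below. *)
Definition same (d : nat) (s s' : state) : Prop :=
  [/\ forall r, r < d -> reg s' r = reg s r, Defs.mem s' = Defs.mem s,
      inp s' = inp s & out s' = out s].

Lemma same_trans d s1 s2 s3 : same d s1 s2 -> same d s2 s3 -> same d s1 s3.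
Proof.
move=> [r1 m1 i1 o1] [r2 m2 i2 o2]; split; rewrite ?m2 ?i2 ?o2 //.
by move=> r rd; rewrite r2 ?r1.
Qed.

Lemma same_le d d' s s' : d' <= d -> same d s s' -> same d' s s'.
Proof.
by move=> dd [hr ? ? ?]; split=> // r rd; apply: hr; exact: leq_trans dd.
Qed.

Lemma same_set d r v s : d <= r -> same d s (set_reg s r v).
Proof.
move=> dr; split=> // q qd; rewrite /= /upd ifN //.
by rewrite neq_ltn (leq_trans qd dr).
Qed.

(** Positional notation in base [C]. The array name is the leading digit and may exceed the base;
    only the three indices must stay below it. *)
Definition addr (C a i j k : nat) := ((a * C + i) * C + j) * C + k.

Lemma digit_inj C x y i j : i < C -> j < C -> x * C + i = y * C + j ->
  x = y /\ i = j.
Proof.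
move=> iC jC e; have C0 : 0 < C by exact: leq_ltn_trans iC.
have := congr1 (divn^~ C) e; have := congr1 (modn^~ C) e.
rewrite /= !modnMDl !modn_small // !divnMDl // !divn_small // !addn0.
by move=> -> ->.
Qed.

Lemma addr_inj C a i j k a' i' j' k' :
  i < C -> j < C -> k < C -> i' < C -> j' < C -> k' < C ->
  addr C a i j k = addr C a' i' j' k' -> [/\ a = a', i = i', j = j' & k = k'].
Proof.
move=> iC jC kC i'C j'C k'C.
by move=> /digit_inj[] // /digit_inj[] // /digit_inj[].
Qed.

(** Memories are compared only at indices below the radix, where addresses do not collide;
    [lbounded] ensures that a program computes no other index. *)
Definition sim (n m : nat) (ls : lstate) (s : state) : Prop :=
  [/\ [/\ reg s 0 = radix n m, reg s 1 = n & reg s 2 = m],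
      forall a i j k, i < radix n m -> j < radix n m -> k < radix n m ->
        Defs.mem s (addr (radix n m) a i j k) = lmem ls a i j k,
      lbounded n m ls, inp s = linp ls & out s = lout ls].

Lemma sim_same n m ls s s' d : 2 < d -> same d s s' ->
  sim n m ls s -> sim n m ls s'.
Proof.
move=> d2 [hr hm hi ho] [[r0 r1 r2] M B I O].
by split; rewrite ?hm ?hi ?ho //; split; rewrite hr //; apply: leq_trans d2.
Qed.

Lemma eval_lt n m s e : lbounded n m s -> eval n m s e < radix n m.
Proof.
move=> B; elim: e => //=.
- by case.
- by rewrite /radix !ltnS (leq_trans (leq_addr m n)).
- by rewrite /radix !ltnS (leq_trans (leq_addl n m)).
- by move=> e _ f _; case: eqP.
- by move=> e IH; case: ifP.
Qed.

Definition copy (d a : nat) := Seq (Const d 0) (Add d d a).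

Lemma copy_ok d a s (Q : state -> Prop) : a != d ->
  (forall s', reg s' d = reg s a -> same d s s' ->
     (forall r, r != d -> reg s' r = reg s r) -> Q s') -> halts (copy d a) s (1 + 1) Q.
Proof.
move=> ad H; step; step; apply: H.
- by rewrite /= /upd eqxx (negPf ad).
- apply: same_trans (same_set _ _ (leqnn d)) (same_set _ _ (leqnn d)).
- by move=> r rd; rewrite /= /upd !(negPf rd).
Qed.

(* The machine cannot multiply: [R[d]] is added to [R[x]] as many times as the
   radix [R[0]] says. *)
Definition push_digit (d x : nat) :=
  Seq (copy d.+1 x) (Seq (copy d.+2 0) (Seq (Const d.+3 1)
  (Seq (While d.+2 (Seq (Add d.+1 d.+1 d) (Defs.Sub d.+2 d.+2 d.+3)))
       (copy d d.+1)))).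

Lemma push_digit_ok d x s C (Q : state -> Prop) :
  0 < d -> x < d -> reg s 0 = C ->
  (forall s', reg s' d = reg s d * C + reg s x -> same d s s' -> Q s') ->
  halts (push_digit d x) s (2 + (2 + (1 + ((1 + C * 3) + 2)))) Q.
Proof.
move=> d0 xd s0 H.
apply: halts_seq; apply: copy_ok => [|s1 e1 m1 f1]; first by lia.
apply: halts_seq; apply: copy_ok => // s2 e2 m2 f2.
step; apply: halts_seq; set s3 := set_reg s2 _ _.
pose I i (s' : state) := [/\ reg s' d.+2 = C - i,
  reg s' d.+1 = reg s x + i * reg s d, reg s' d = reg s d, reg s' d.+3 = 1
  & same d s s'].
have I0 : I 0 s3.
  split.
  - by rewrite subn0 -s0 -(f1 0) -?e2; [regs | lia].
  - by rewrite addn0 -e1 -(f2 d.+1); [regs | lia].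
  - by rewrite -(f1 d) -?(f2 d); [regs | lia..].
  - by regs.
  - apply: same_trans (same_le _ m1) _ => //.
    apply: same_trans (same_le _ m2) _; first by lia.
    by apply: same_set; lia.
apply: haltsW (leqnn _) _; first apply: (halts_while (k := C) (T := 1 + 1) I0).
- by move=> i ? _ [].
- move=> i s' iC [h2 h1 hd h3 hm]; step; step; split.
  + by regs.
  + by rewrite mulSn; regs.
  + by regs.
  + by regs.
  + apply: same_trans hm _; apply: same_trans (same_set _ _ (leqnSn d)) _.
    by apply: same_set; lia.
- move=> s4 [h2 h1 hd h3 hm]; apply: copy_ok => [|s5 e5 m5 f5]; first by lia.
  apply: H; first by rewrite e5 h1 addnC mulnC.
  exact: same_trans hm m5.
Qed.

Definition address (a x y z d : nat) :=
  Seq (Const d a) (Seq (push_digit d x) (Seq (push_digit d y) (push_digit d z))).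

Definition address_time C := 1 + ((2 + (2 + (1 + ((1 + C * 3) + 2)))) +
  ((2 + (2 + (1 + ((1 + C * 3) + 2)))) + (2 + (2 + (1 + ((1 + C * 3) + 2)))))).

Lemma address_ok a x y z d s C (Q : state -> Prop) :
  0 < d -> x < d -> y < d -> z < d -> reg s 0 = C ->
  (forall s', reg s' d = addr C a (reg s x) (reg s y) (reg s z) ->
     same d s s' -> Q s') ->
  halts (address a x y z d) s (address_time C) Q.
Proof.
move=> d0 xd yd zd s0 H; step; set s1 := set_reg _ _ _.
have m1 : same d s s1 by exact: same_set.
have [f1 _ _ _] := m1.
apply: halts_seq; apply: (push_digit_ok (C := C)) => //; first by rewrite f1.
move=> s2 e2 m2; have [f2 _ _ _] := m2.
apply: halts_seq; apply: (push_digit_ok (C := C)) => //; first by rewrite f2 ?f1.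
move=> s3 e3 m3; have [f3 _ _ _] := m3.
apply: (push_digit_ok (C := C)) => //; first by rewrite f3 ?f2 ?f1.
move=> s4 e4 m4; apply: H; last first.
  by do 3!(apply: same_trans; last eassumption).
have e1 : reg s1 d = a by regs.
by rewrite e4 e3 e2 e1 (f3 z) ?(f2 z) ?(f1 z) ?(f2 y) ?(f1 y) ?(f1 x).
Qed.

Lemma poly_bounded_address_time : poly_bounded address_time.
Proof. by rewrite /address_time; poly_bound. Qed.

(** Program and time bound are chosen before [n] and [m], so the compilation is uniform in the
    input. The arbitrary postcondition [Q] lets the lemma be chained like an instruction. *)
Lemma expr_compiles e d : 2 < d -> exists P T, poly_bounded T /\
  forall n m ls s (Q : state -> Prop), sim n m ls s ->
    (forall s', reg s' d = eval n m ls e -> same d s s' -> Q s') ->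
    halts P s (T (radix n m)) Q.
Proof.
elim: e d => [b||| a e1 IH1 e2 IH2 e3 IH3 | e1 IH1 e2 IH2 | e IH] d d2.
- exists (Const d b), (fun=> 1); split; first exact: poly_bounded_cst.
  move=> n m ls s Q _ H; step; apply: H; last exact: same_set.
  by rewrite /= /upd eqxx.
- exists (copy d 1), (fun=> 2); split; first exact: poly_bounded_cst.
  move=> n m ls s Q [[_ r1 _] _ _ _ _] H; apply: copy_ok.
    by rewrite neq_ltn (ltn_trans _ d2).
  by move=> s' e m1 _; apply: H; rewrite // e r1.
- exists (copy d 2), (fun=> 2); split; first exact: poly_bounded_cst.
  move=> n m ls s Q [[_ _ r2] _ _ _ _] H; apply: copy_ok.
    by rewrite neq_ltn d2.
  by move=> s' e m1 _; apply: H; rewrite // e r2.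
- have d3 : 2 < d.+1 by exact: leqW.
  have d4 : 2 < d.+2 by exact: leqW.
  have [P1 [T1 [b1 h1]]] := IH1 _ d2.
  have [P2 [T2 [b2 h2]]] := IH2 _ d3.
  have [P3 [T3 [b3 h3]]] := IH3 _ d4.
  exists (Seq P1 (Seq P2 (Seq P3 (Seq (address a d d.+1 d.+2 d.+3) (Fetch d d.+3))))).
  exists (fun C => T1 C + (T2 C + (T3 C + (address_time C + 1)))); split.
    by poly_bound; exact: poly_bounded_address_time.
  move=> n m ls s Q S H.
  apply: halts_seq; apply: (h1 _ _ _ _ _ S) => s1 e1' m1.
  have S1 := sim_same d2 m1 S.
  apply: halts_seq; apply: (h2 _ _ _ _ _ S1) => s2 e2' m2.
  have S2 := sim_same d3 m2 S1.
  apply: halts_seq; apply: (h3 _ _ _ _ _ S2) => s3 e3' m3.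
  have S3 := sim_same d4 m3 S2.
  have [f1 _ _ _] := m1; have [f2 _ _ _] := m2; have [f3 _ _ _] := m3.
  have [[r0 _ _] _ _ _ _] := S3.
  apply: halts_seq; apply: (address_ok _ _ _ _ r0); [lia.. | move=> s4 e4 m4].
  have S4 := sim_same (leqW d4) m4 S3.
  have {}e4 : reg s4 d.+3 = addr (radix n m) a
      (eval n m ls e1) (eval n m ls e2) (eval n m ls e3).
    by rewrite e4 e3' f3 // f3 ?ltnS // f2 // e1' e2'.
  step; apply: H.
  + rewrite /= /upd eqxx e4; case: S4 => _ M B _ _.
    by apply: M; exact: eval_lt.
  + apply: same_trans m1 _; apply: same_trans (same_le _ m2) _ => //.
    apply: same_trans (same_le _ m3) _; first by rewrite !leqW.
    apply: same_trans (same_le _ m4) (same_set _ _ (leqnn d)).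
    by rewrite !leqW.
- have d3 : 2 < d.+1 by exact: leqW.
  have [P1 [T1 [b1 h1]]] := IH1 _ d2.
  have [P2 [T2 [b2 h2]]] := IH2 _ d3.
  (* The two truncated differences add up to the distance of the operands, which is zero exactly
     when they are equal. *)
  exists (Seq P1 (Seq P2 (Seq (Defs.Sub d.+2 d d.+1) (Seq (Defs.Sub d d.+1 d)
    (Seq (Add d d d.+2) (If d (Const d 0) (Const d 1))))))).
  exists (fun C => T1 C + (T2 C + (1 + (1 + (1 + 2))))); split.
    by do 2!apply: poly_boundedD => //; exact: poly_bounded_cst.
  move=> n m ls s Q S H.
  apply: halts_seq; apply: (h1 _ _ _ _ _ S) => s1 e1' m1.
  have S1 := sim_same d2 m1 S.
  apply: halts_seq; apply: (h2 _ _ _ _ _ S1) => s2 e2' m2.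
  have [f2 _ _ _] := m2.
  step; step; step; rewrite /set_reg /=; set s3 := State _ _ _ _.
  have e3 : reg s3 d = (eval n m ls e2 - eval n m ls e1) +
                       (eval n m ls e1 - eval n m ls e2).
    by rewrite -e2' -e1' -(f2 d) //; regs.
  have m3 : same d s s3.
    apply: same_trans m1 _; apply: same_trans (same_le _ m2) _ => //.
    apply: same_trans (same_set _ _ _) _; last first.
      apply: same_trans (same_set _ _ _) _; last exact: same_set.
      exact: leqnn.
    exact: (leqW (leqnSn d)).
  apply: halts_if => r0; step; apply: H.
  + rewrite /= /upd eqxx; case: eqP => // e12.
    by move: r0; rewrite e3 e12 subnn.
  + exact: same_trans m3 (same_set _ _ _).
  + rewrite /= /upd eqxx eqn_leq -!subn_eq0.
    by move: r0; rewrite e3 addn_eq0 => /andP[-> ->].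
  + exact: same_trans m3 (same_set _ _ _).
- have [P [T [b h]]] := IH _ d2.
  (* The radix minus the successor is nonzero exactly when the successor is still below the radix;
     this implements the clamp. *)
  exists (Seq P (Seq (Const d.+1 1) (Seq (Add d.+1 d.+1 d) (Seq (Defs.Sub d.+2 0 d.+1)
    (If d.+2 (copy d d.+1) Skip))))).
  exists (fun C => T C + (1 + (1 + (1 + 3)))); split.
    by apply: poly_boundedD => //; exact: poly_bounded_cst.
  move=> n m ls s Q S H.
  apply: halts_seq; apply: (h _ _ _ _ _ S) => s1 e1 m1.
  have S1 := sim_same d2 m1 S.
  have [[r0 _ _] _ _ _ _] := S1.
  step; step; step; rewrite /set_reg /=; set s2 := State _ _ _ _.
  have m2 : same d s s2.
    apply: same_trans m1 _.
    apply: same_trans (same_set _ _ (leqnSn d)) _.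
    apply: same_trans (same_set _ _ (leqnSn d)) _.
    exact: same_set (leqW (leqnSn d)).
  have x1 : reg s2 d.+1 = (eval n m ls e).+1 by rewrite -e1; regs.
  have x2 : reg s2 d.+2 = radix n m - (eval n m ls e).+1.
    by rewrite -e1 -r0; regs.
  apply: (@halts_if _ _ _ _ 2) => r.
  + apply: copy_ok => [|s3 e3 m3 _]; first by rewrite neq_ltn ltnSn orbT.
    apply: H; last exact: same_trans m2 m3.
    rewrite e3 x1 /= ifT //; move: r; rewrite x2 subn_eq0 -ltnNge.
    by [].
  + apply: (haltsW (T := 1) (Q := eq s2)) => // [|_ <-]; first by step.
    apply: H => //=; rewrite ifN; last by rewrite -leqNgt -subn_eq0 -x2.
    by rewrite -e1; regs.
Qed.

Lemma sim_store n m ls s a i j k v d :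
  sim n m ls s -> i < radix n m -> j < radix n m -> k < radix n m ->
  reg s v < radix n m -> reg s d = addr (radix n m) a i j k ->
  sim n m (lset ls a i j k (reg s v))
    (State (reg s) (upd (Defs.mem s) (reg s d) (reg s v)) (inp s) (out s)).
Proof.
move=> [R M B I O] iC jC kC vC ->; split=> //= [a' i' j' k' i'C j'C k'C|a' i' j' k'].
- rewrite /lupd /upd; case: eqP => [e|ne].
    by have [-> -> -> ->] := addr_inj i'C j'C k'C iC jC kC e; rewrite !eqxx.
  case: ifP => [/and4P[/eqP ea /eqP ei /eqP ej /eqP ek]|_]; last exact: M.
  by case: ne; rewrite ea ei ej ek.
- by rewrite /= /lupd; case: ifP.
Qed.

(** The value waits in register [d] while the indices are computed above it; its bound keeps the
    memory [lbounded]. *)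
Lemma store_compiles a i j k d : 2 < d -> exists P T, poly_bounded T /\
  forall n m ls s (Q : state -> Prop), sim n m ls s ->
    reg s d < radix n m ->
    (forall s', (forall r, r <= d -> reg s' r = reg s r) ->
       sim n m (lset ls a (eval n m ls i) (eval n m ls j) (eval n m ls k)
                  (reg s d)) s' -> Q s') ->
    halts P s (T (radix n m)) Q.
Proof.
move=> d2.
have d3 : 2 < d.+1 by lia.
have d4 : 2 < d.+2 by lia.
have d5 : 2 < d.+3 by lia.
have [P1 [T1 [b1 h1]]] := expr_compiles i d3.
have [P2 [T2 [b2 h2]]] := expr_compiles j d4.
have [P3 [T3 [b3 h3]]] := expr_compiles k d5.
exists (Seq P1 (Seq P2 (Seq P3
  (Seq (address a d.+1 d.+2 d.+3 d.+4) (Defs.Store d.+4 d))))).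
exists (fun C => T1 C + (T2 C + (T3 C + (address_time C + 1)))); split.
  by poly_bound; exact: poly_bounded_address_time.
move=> n m ls s Q S dC H.
apply: halts_seq; apply: (h1 _ _ _ _ _ S) => s1 e1 m1.
have S1 := sim_same d3 m1 S.
apply: halts_seq; apply: (h2 _ _ _ _ _ S1) => s2 e2 m2.
have S2 := sim_same d4 m2 S1.
apply: halts_seq; apply: (h3 _ _ _ _ _ S2) => s3 e3 m3.
have S3 := sim_same d5 m3 S2.
have [f1 _ _ _] := m1; have [f2 _ _ _] := m2; have [f3 _ _ _] := m3.
have [[r0 _ _] _ _ _ _] := S3.
apply: halts_seq; apply: (address_ok _ _ _ _ r0); [lia.. | move=> s4 e4 m4].
have S4 := sim_same (leqW d5) m4 S3; have [f4 _ _ _] := m4.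
have fd r : r <= d -> reg s4 r = reg s r.
  by move=> rd; rewrite f4 ?f3 ?f2 ?f1 //; lia.
have {}e4 : reg s4 d.+4 = addr (radix n m) a
    (eval n m ls i) (eval n m ls j) (eval n m ls k).
  by rewrite e4 e3 (f3 d.+1) ?(f3 d.+2) ?(f2 d.+1) ?e1 ?e2 //; lia.
have B : lbounded n m ls by case: S.
step; apply: H; first exact: fd.
rewrite -(fd d) //; apply: sim_store => //; try exact: eval_lt.
by rewrite fd.
Qed.

Lemma eval_lmem n m s s' e :
  lmem s = lmem s' -> eval n m s e = eval n m s' e.
Proof.
move=> h; elim: e => //= [a e1 -> e2 -> e3 ->|e1 -> e2 ->|e1 ->] //.
by rewrite h.
Qed.

Lemma sim_reg n m ls s s' :
  sim n m ls s -> (forall r, r <= 2 -> reg s' r = reg s r) ->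
  Defs.mem s' = Defs.mem s -> inp s' = inp s -> out s' = out s -> sim n m ls s'.
Proof.
move=> [[r0 r1 r2] M B I O] hr hm hi ho.
by split; rewrite ?hm ?hi ?ho //; split; rewrite hr.
Qed.

Lemma stmt_compiles c d : 2 < d -> exists P T, poly_bounded T /\
  forall n m ls s (Q : state -> Prop), sim n m ls s ->
    (forall s', (forall r, r < d -> reg s' r = reg s r) ->
       sim n m (sem n m c ls) s' -> Q s') ->
    halts P s (T (radix n m)) Q.
Proof.
elim: c d => [|a i j k e|a i j k|e|c1 IH1 c2 IH2|e c1 IH1 c2 IH2|a e c IH] d d2.
- exists Skip, (fun=> 1); split; first by poly_bound.
  by move=> n m ls s Q S H; step; apply: H.
- have [P1 [T1 [b1 h1]]] := expr_compiles e d2.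
  have [P2 [T2 [b2 h2]]] := store_compiles a i j k d2.
  exists (Seq P1 P2), (fun C => T1 C + T2 C); split; first by poly_bound.
  move=> n m ls s Q S H.
  apply: halts_seq; apply: (h1 _ _ _ _ _ S) => s1 e1 m1.
  have S1 := sim_same d2 m1 S; have [f1 _ _ _] := m1.
  have B : lbounded n m ls by case: S.
  apply: (h2 _ _ _ _ _ S1) => [|s2 f2]; rewrite e1; first exact: eval_lt.
  by apply: H => r rd; rewrite f2 ?f1 // ltnW.
- have [P [T [b h]]] := store_compiles a i j k d2.
  exists (Seq (Read d) (Seq (Defs.Sub d.+1 0 d)
    (Seq (If d.+1 Skip (Const d 0)) P))).
  exists (fun C => 1 + (1 + (2 + T C))); split; first by poly_bound.
  move=> n m ls s Q S H; step; step; rewrite /set_reg /=.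
  set s1 := State _ _ _ _.
  have S1 : sim n m (LState (lmem ls) (behead (linp ls)) (lout ls)) s1.
    case: S => [[r0 r1 r2] M B I O]; split; rewrite /= ?I //.
    by split; rewrite -?r0 -?r1 -?r2; regs.
  have [[r0 _ _] _ _ I _] := S.
  have x1 : reg s1 d.+1 = radix n m - head 0 (linp ls).
    by rewrite -r0 -I; regs.
  have x0 : reg s1 d = head 0 (linp ls) by rewrite -I; regs.
  have f1 r : r < d -> reg s1 r = reg s r by move=> rd; regs.
  pose v := if head 0 (linp ls) < radix n m then head 0 (linp ls) else 0.
  have vC : v < radix n m by rewrite /v; case: ifP.
  have K s2 : (forall r, r < d -> reg s2 r = reg s1 r) ->
      Defs.mem s2 = Defs.mem s1 -> inp s2 = inp s1 -> out s2 = out s1 ->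
      reg s2 d = v -> halts P s2 (T (radix n m)) Q.
    move=> f2 m2 i2 o2 e2.
    have S2 := sim_reg S1 (fun r rd => f2 r (leq_ltn_trans rd d2)) m2 i2 o2.
    apply: (h _ _ _ _ _ S2); rewrite e2 // => s3 f3 S3.
    apply: H; first by move=> r rd; rewrite f3 ?f2 ?f1 // ltnW.
    move: S3; rewrite /= -/v.
    by rewrite !(@eval_lmem _ _ (LState (lmem ls) (behead (linp ls)) (lout ls)) ls).
  apply: halts_seq; apply: halts_if => z; step; apply: K => //.
  + by rewrite x0 /v ifT //; lia.
  + by move=> r rd; regs.
  + by rewrite /= /upd eqxx /v ifN //; lia.
- have [P [T [b h]]] := expr_compiles e d2.
  exists (Seq P (Write d)), (fun C => T C + 1); split; first by poly_bound.
  move=> n m ls s Q S H.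
  apply: halts_seq; apply: (h _ _ _ _ _ S) => s1 e1 m1.
  have S1 := sim_same d2 m1 S; have [f1 _ _ _] := m1.
  step; apply: H => //; case: S1 => R M B I O; split=> //=.
  by rewrite O e1.
- have [P1 [T1 [b1 h1]]] := IH1 _ d2.
  have [P2 [T2 [b2 h2]]] := IH2 _ d2.
  exists (Seq P1 P2), (fun C => T1 C + T2 C); split; first by poly_bound.
  move=> n m ls s Q S H.
  apply: halts_seq; apply: (h1 _ _ _ _ _ S) => s1 f1 S1.
  apply: (h2 _ _ _ _ _ S1) => s2 f2 S2.
  by apply: H S2 => r rd; rewrite f2 ?f1.
- have [P [T [b h]]] := expr_compiles e d2.
  have [P1 [T1 [b1 h1]]] := IH1 _ d2.
  have [P2 [T2 [b2 h2]]] := IH2 _ d2.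
  (* The sum dominates either branch and, unlike a maximum, is visibly polynomial. *)
  exists (Seq P (If d P1 P2)), (fun C => T C + (1 + (T1 C + T2 C))).
  split; first by poly_bound.
  move=> n m ls s Q S H.
  apply: halts_seq; apply: (h _ _ _ _ _ S) => s1 e1 m1.
  have S1 := sim_same d2 m1 S; have [f1 _ _ _] := m1.
  apply: halts_if; rewrite e1 => r0.
  + apply: (haltsW (T := T1 (radix n m)) (Q := Q)) => //; last exact: leq_addr.
    apply: (h1 _ _ _ _ _ S1) => s2 f2 S2; apply: H.
      by move=> r rd; rewrite f2 ?f1.
    by rewrite /= r0.
  + apply: (haltsW (T := T2 (radix n m)) (Q := Q)) => //; last exact: leq_addl.
    apply: (h2 _ _ _ _ _ S1) => s2 f2 S2; apply: H.
      by move=> r rd; rewrite f2 ?f1.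
    by rewrite /= r0.
- have d3 : 2 < d.+1 by lia.
  have d4 : 2 < d.+2 by lia.
  have [P [T [b h]]] := expr_compiles e d2.
  have [P1 [T1 [b1 h1]]] :=
    store_compiles a (EBool false) (EBool false) (EBool false) d3.
  have [P2 [T2 [b2 h2]]] := IH _ d4.
  (* Register [d] counts the remaining iterations and [d.+1] holds the index, which is copied to the
     loop variable each time. Hence a body that overwrites this variable, or the bound, does not
     change the number of iterations, in agreement with [foldl] over [iota]. That number is below
     the radix [C]. *)
  exists (Seq P (Seq (Const d.+1 0) (While d (Seq P1 (Seq P2 (Seq (Const d.+2 1)
    (Seq (Add d.+1 d.+1 d.+2) (Defs.Sub d d d.+2)))))))).
  exists (fun C => T C + (1 + (1 + C * (1 + (T1 C + (T2 C + (1 + (1 + 1)))))))).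
  split; first by poly_bound.
  move=> n m ls s Q S H.
  have B : lbounded n m ls by case: S.
  apply: halts_seq; apply: (h _ _ _ _ _ S) => s1 e1 m1.
  have S1 := sim_same d2 m1 S; have [f1 _ _ _] := m1.
  step; set s2 := set_reg _ _ _.
  set bd := eval n m ls e in e1.
  have bC : bd < radix n m by exact: eval_lt.
  pose I i (s' : state) := [/\ reg s' d = bd - i, reg s' d.+1 = i,
    forall r, r < d -> reg s' r = reg s r &
    sim n m (foldl (fun s i => sem n m c (lset s a 0 0 0 i)) ls (iota 0 i)) s'].
  have I0 : I 0 s2.
    split.
    + by rewrite subn0 -e1; regs.
    + by regs.
    + by move=> r rd; rewrite -f1 //; regs.
    + by apply: sim_reg S1 _ _ _ _ => // r rd; regs.
  apply: (haltsW (T := (bd * (T1 (radix n m) + (T2 (radix n m) + (1 + (1 + 1)))).+1).+1)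
    (Q := I bd)).
  + apply: halts_while I0 _ _; first by move=> i ? _ [].
    move=> i s' ib [rd rd1 f S'].
    apply: halts_seq; apply: (h1 _ _ _ _ _ S').
      by rewrite rd1 (ltn_trans ib).
    move=> s3 f3 S3; rewrite rd1 /= in S3.
    apply: halts_seq; apply: (h2 _ _ _ _ _ S3) => s4 f4 S4.
    have r4 : reg s4 d = bd - i by rewrite f4 ?f3 //; lia.
    have r4' : reg s4 d.+1 = i by rewrite f4 ?f3 //; lia.
    step; step; step; split.
    * by rewrite subnS -r4; regs.
    * by regs.
    * by move=> r rd'; rewrite -f // -f3 ?leqW // ?(ltnW rd') // -f4; [regs | lia].
    * rewrite -addn1 iotaD foldl_cat add0n /=.
      by apply: sim_reg S4 _ _ _ _ => // r rd'; regs.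
  + by rewrite -[X in X <= _]add1n leq_add2l leq_mul // ltnW.
  + by move=> s' [_ _ f S']; apply: H.
Qed.

Definition linit (w : seq nat) : lstate := LState (fun _ _ _ _ => 0) w [::].

(** If [n] or [m] is zero, the bound is the constant [p.[0]] whatever the other one is, so the
    program answers at once with 0, the code of an empty list. *)
Lemma program_compiles c : exists (P : prog) (p : {poly nat}),
  forall n m w, exists t, computes_in P [:: n, m & w] t
      (if (n == 0) || (m == 0) then [:: 0] else lout (sem n m c (linit w))) /\
    t <= (p.[(n * m)%N])%R.
Proof.
have [P [T [[p bp] h]]] := stmt_compiles c (leqnn 3).
exists (Seq (Read 1) (Seq (Read 2) (If 1 (If 2 (Seq (Add 0 1 2) (Seq (Const 3 2)
  (Seq (Add 0 0 3) P))) (Write 0)) (Write 0)))).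
(* Seven steps read and test [n] and [m] and set the radix, which is at most [n * m + 3] when both
   are positive. *)
exists (polyC 7%N + (p \Po ('X + polyC 3%N)))%R => n m w.
pose v := if (n == 0) || (m == 0) then [:: 0] else lout (sem n m c (linit w)).
suff [t [s [e tT q]]] : halts (Seq (Read 1) (Seq (Read 2) (If 1 (If 2
    (Seq (Add 0 1 2) (Seq (Const 3 2) (Seq (Add 0 0 3) P))) (Write 0)) (Write 0))))
    (init [:: n, m & w]) (1 + (1 + (1 + (1 + (1 + (1 + (1 + (p.[(n * m + 3)%N])%R)))))))
    (fun s => out s = v).
  exists t; split; first by exists s.
  apply: leq_trans tT _.
  by rewrite hornerD hornerC horner_comp hornerD hornerX hornerC.
step; step; rewrite /= /upd /=.
have W s : out s = [::] -> reg s 0 = 0 -> (n == 0) || (m == 0) ->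
    forall T', halts (Write 0) s (1 + T') (fun s => out s = v).
  move=> o0 r0 z T'; apply: (haltsW (T := 1) (Q := fun s => out s = v)) => //.
  by step; rewrite /= o0 r0 /v z.
apply: halts_if; rewrite /=; last first.
  move=> n0; apply: (W _ _ _ _ (1 + (1 + (1 + (p.[(n * m + 3)%N])%R)))) => //.
  by rewrite n0.
move=> n0; apply: halts_if; rewrite /=; last first.
  move=> m0; apply: (W _ _ _ _ (1 + (1 + (p.[(n * m + 3)%N])%R))) => //.
  by rewrite m0 orbT.
move=> m0; step; step; step; rewrite /set_reg /=; set s := State _ _ _ _.
have S : sim n m (linit w) s.
  by split; rewrite /s /upd //=; split=> //=; rewrite /radix addnC.
have le : T (radix n m) <= (p.[(n * m + 3)%N])%R.
  apply: leq_trans (bp _) (horner_nat_mono _ _); rewrite /radix; nia.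
apply: haltsW le (fun s H => H).
apply: (h _ _ _ _ _ S) => s' _ [_ _ _ _ ->].
by rewrite /v (negPf n0) (negPf m0).
Qed.

(** * Sifting through a table of coset representatives *)

Section Sifting.
Local Open Scope group_scope.
Variable n : nat.
Implicit Types (tb : 'I_n -> 'I_n -> option 'S_n) (p q u : 'S_n).

(** In a product the left factor acts first, so if [u l = p l] then [p * u^-1] fixes [l]: each level
    makes one more point fixed, and only the identity survives all of them. *)
Fixpoint sift tb (ls : seq 'I_n) p : bool :=
  if ls is l :: ls' then
    if tb l (p l) is Some u then sift tb ls' (p * u^-1) else false
  else p == 1.

Definition fixes_below (k : nat) p : Prop := forall x : 'I_n, x < k -> p x = x.

(** The identities on the diagonal let a permutation that fixes the points below [k] pass the first
    [k] levels unchanged. *)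
Definition transversals tb : Prop :=
  (forall l, tb l l = Some 1) /\
  (forall l j u, tb l j = Some u -> u l = j /\ fixes_below l u).

Definition entries tb : {set 'S_n} :=
  [set u | [exists l, exists j, tb l j == Some u]].

Definition subtable tb tb' : Prop :=
  forall l j u, tb l j = Some u -> tb' l j = Some u.

Lemma entriesP tb u : reflect (exists l j, tb l j = Some u) (u \in entries tb).
Proof.
rewrite inE; apply: (iffP existsP) => [[l /existsP[j /eqP e]]|[l [j e]]].
  by exists l, j.
by exists l; apply/existsP; exists j; apply/eqP.
Qed.

Lemma subtable_trans tb1 tb2 tb3 :
  subtable tb1 tb2 -> subtable tb2 tb3 -> subtable tb1 tb3.
Proof. by move=> h1 h2 l j u /h1/h2. Qed.

Lemma sift_mono tb tb' ls p : subtable tb tb' -> sift tb ls p -> sift tb' ls p.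
Proof.
move=> h; elim: ls p => //= l ls IH p.
by case e: (tb l (p l)) => [u|//]; rewrite (h _ _ _ e); exact: IH.
Qed.

Lemma fixes_all p : fixes_below n p -> p = 1.
Proof. by move=> h; apply/permP => x; rewrite perm1 h. Qed.

Lemma fixes_belowM k p q :
  fixes_below k p -> fixes_below k q -> fixes_below k (p * q).
Proof. by move=> hp hq x xk; rewrite permM hp ?hq. Qed.

Lemma fixes_belowV k p : fixes_below k p -> fixes_below k p^-1.
Proof. by move=> hp x xk; rewrite -{1}(hp x xk) permK. Qed.

Lemma fixes_below_step tb (l : 'I_n) p u : transversals tb -> fixes_below l p ->
  tb l (p l) = Some u -> fixes_below l.+1 (p * u^-1).
Proof.
move=> [_ h] fp /h[ul fu] x; rewrite ltnS leq_eqVlt => /orP[/eqP/val_inj->|xl].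
  by rewrite permM -ul permK.
by rewrite permM fp // (fixes_belowV fu).
Qed.

Lemma drop_enum_ord (l : 'I_n) :
  drop l (enum 'I_n) = l :: drop l.+1 (enum 'I_n).
Proof.
by rewrite (drop_nth l) ?size_enum_ord // nth_ord_enum.
Qed.

Lemma sift_fixes_below tb p k : transversals tb -> k <= n -> fixes_below k p ->
  sift tb (enum 'I_n) p = sift tb (drop k (enum 'I_n)) p.
Proof.
move=> [h1 _]; elim: k => [|k IH] kn fp; first by rewrite drop0.
rewrite IH ?(ltnW kn) //; last by move=> x xk; rewrite fp // ltnW.
rewrite (drop_enum_ord (Ordinal kn)) /= fp //.
by rewrite h1 invg1 mulg1.
Qed.

(** * Completeness of a table closed under products *)

Section Complete.
Variable tb : 'I_n -> 'I_n -> option 'S_n.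
Hypothesis tb_tr : transversals tb.
Hypothesis tb_closed : forall u w, u \in entries tb -> w \in entries tb ->
  sift tb (enum 'I_n) (u * w).

(** These entries generate a subgroup of the pointwise stabiliser of the points below [k], the
    [k]-th group of a stabiliser chain. *)
Let above (k : nat) : {set 'S_n} :=
  [set u | [exists l : 'I_n, (k <= l) && [exists j, tb l j == Some u]]].

Let aboveP k u :
  reflect (exists (l j : 'I_n), k <= l /\ tb l j = Some u) (u \in above k).
Proof.
rewrite inE; apply: (iffP existsP) => [[l /andP[kl /existsP[j /eqP e]]]|].
  by exists l, j.
by move=> [l [j [kl e]]]; exists l; rewrite kl; apply/existsP; exists j; apply/eqP.
Qed.

Let above_fixes k g : g \in <<above k>> -> fixes_below k g.
Proof.
suff /subsetP h : <<above k>> \subset 'C([set x : 'I_n | x < k] | 'P).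
  by move=> /h /astabP hg x xk; apply: hg; rewrite inE.
rewrite gen_subG; apply/subsetP => u /aboveP[l [j [kl /(proj2 tb_tr)[_ fu]]]].
by apply/astabP => x; rewrite inE => xk; apply: fu; exact: leq_trans kl.
Qed.

Let sift_above k p : k <= n ->
  sift tb (drop k (enum 'I_n)) p -> p \in <<above k>>.
Proof.
move=> kn; have [r e] : exists r, k + r = n by exists (n - k); lia.
elim: r k kn p e => [|r IH] k kn p e.
  rewrite drop_oversize ?size_enum_ord //=; last by lia.
  by move/eqP->; exact: group1.
have kn' : k < n by lia.
rewrite (drop_enum_ord (Ordinal kn')) /=.
case eu: (tb _ _) => [u|//] /(IH k.+1 kn' _ ltac:(lia)) h.
rewrite -[p](mulgKV u); apply: groupM.
  apply: subsetP h; apply: genS; apply/subsetP => v /aboveP[l [j [kl ev]]].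
  by apply/aboveP; exists l, j; split=> //; exact: ltnW.
by apply: mem_gen; apply/aboveP; exists (Ordinal kn'); eexists; split; last exact: eu.
Qed.

(* Downward induction on the level k.  Once <<above k.+1>> is known to be the
   set of elements that sift from level k.+1 on, the elements that sift from
   level k on form the product <<above k.+1>> * U_k, and closure of the table
   makes this set stable under right multiplication by <<above k>>. *)
Let above_sift k g : k <= n ->
  g \in <<above k>> -> sift tb (drop k (enum 'I_n)) g.
Proof.
move=> kn; have [r e] : exists r, k + r = n by exists (n - k); lia.
elim: r k kn g e => [|r IH] k kn g e gk.
  rewrite drop_oversize ?size_enum_ord //=; last by lia.
  apply/eqP/fixes_all; rewrite -[n]e addn0; exact: above_fixes gk.
have kn' : k < n by lia.
pose l := Ordinal kn'.
pose P := [set p | sift tb (drop k (enum 'I_n)) p].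
have PE p : reflect (exists h u, [/\ h \in <<above k.+1>>, tb l (u l) = Some u
    & p = h * u]) (p \in P).
  rewrite inE (drop_enum_ord l) /=; apply: (iffP idP).
    case eu: (tb _ _) => [u|//] /(sift_above kn') h; exists (p * u^-1), u.
    by rewrite mulgKV; split=> //; have [-> _] := proj2 tb_tr _ _ _ eu.
  move=> [h [u [hk eu ->]]].
  have -> : (h * u) l = u l by rewrite permM (above_fixes hk).
  by rewrite eu mulgK; apply: IH => //; lia.
pose Q := [set x | [forall p, (p \in P) ==> (p * x \in P)]].
have QP x : reflect (forall p, p \in P -> p * x \in P) (x \in Q).
  rewrite inE; apply: (iffP forallP) => h p; last exact/implyP/h.
  exact/implyP.
have gQ : group_set Q.
  apply/group_setP; split; first by apply/QP => p; rewrite mulg1.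
  by move=> x y /QP hx /QP hy; apply/QP => p /hx/hy; rewrite mulgA.
have aQ : <<above k>> \subset Q.
  rewrite -[Q]/(gval (Group gQ)) gen_subG; apply/subsetP => w /aboveP[i [j [ki ew]]].
  apply/QP => p /PE[h [u [hk eu ->]]].
  (* Both factors fix the points below [k], so closure, which speaks of sifting from level 0, yields
     sifting from level [k]. *)
  have : u * w \in P.
    rewrite inE -sift_fixes_below //.
      by apply: tb_closed; apply/entriesP; [exists l, (u l) | exists i, j].
    have [_ fu] := proj2 tb_tr _ _ _ eu; have [_ fw] := proj2 tb_tr _ _ _ ew.
    apply: fixes_belowM; first exact: fu.
    by move=> x xk; apply: fw; exact: leq_trans ki.
  move=> /PE[h' [u' [hk' eu' e']]]; apply/PE; exists (h * h'), u'.
  by rewrite -mulgA e' mulgA; split=> //; exact: groupM.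
(* The identity sifts, and [P] is stable under right multiplication by [g]. *)
have /QP/(_ 1) := subsetP aQ _ gk; rewrite mul1g !inE; apply.
rewrite (drop_enum_ord l) /= perm1 (proj1 tb_tr) mulgV.
by apply: IH; rewrite ?group1 //; lia.
Qed.

Lemma sift_complete g : sift tb (enum 'I_n) g = (g \in <<entries tb>>).
Proof.
have -> : entries tb = above 0.
  apply/setP => u; apply/entriesP/aboveP => [[l [j e]]|[l [j [_ e]]]];
  by exists l, j.
by apply/idP/idP => h; [apply: sift_above|rewrite -[enum _]drop0; apply: above_sift];
  rewrite ?drop0.
Qed.
End Complete.

(** Elements that sift lie in the group generated by the entries, so testing the generators in [S]
    is enough to identify the two groups. *)
Lemma sift_gen tb (S : {set 'S_n}) g : transversals tb ->
  (forall u w, u \in entries tb -> w \in entries tb ->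
     sift tb (enum 'I_n) (u * w)) ->
  {subset entries tb <= <<S>>} ->
  (forall s, s \in S -> sift tb (enum 'I_n) s) ->
  sift tb (enum 'I_n) g = (g \in <<S>>).
Proof.
move=> tr cl sub gen; rewrite sift_complete //; suff -> : <<entries tb>> = <<S>> by [].
apply/eqP; rewrite eqEsubset !gen_subG; apply/andP; split; apply/subsetP => x xs.
  exact: sub.
by rewrite -sift_complete // gen.
Qed.

Definition insert tb l q : 'I_n -> 'I_n -> option 'S_n :=
  fun l' j' => if (l' == l) && (j' == q l) then Some q else tb l' j'.

Lemma subtable_insert tb l q : tb l (q l) = None -> subtable tb (insert tb l q).
Proof.
move=> e l' j' u h; rewrite /insert; case: andP => // -[/eqP el /eqP ej].
by move: h; rewrite el ej e.
Qed.

Lemma transversals_insert tb (l : 'I_n) q : transversals tb -> fixes_below l q ->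
  tb l (q l) = None -> transversals (insert tb l q).
Proof.
move=> [h1 h2] fq e; split=> [l'|l' j' u].
  exact: subtable_insert.
rewrite /insert; case: andP => [[/eqP-> /eqP->] [<-]|_] //; exact: h2.
Qed.

Lemma sift1 tb ls : transversals tb -> sift tb ls 1.
Proof. by move=> [h1 _]; elim: ls => //= l ls IH; rewrite perm1 h1 /= mulgV. Qed.

(** An inserted residue is divided by itself and leaves the identity. *)
Lemma sift_insert tb (l : 'I_n) q :
  sift (insert tb l q) (drop l (enum 'I_n)) q =
  sift (insert tb l q) (drop l.+1 (enum 'I_n)) 1.
Proof. by rewrite drop_enum_ord /= /insert !eqxx /= mulgV. Qed.

End Sifting.

(** * Separable sets of points *)

Section Separable.
Local Open Scope group_scope.
Variables (n : nat) (H : {group 'S_n}).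
Implicit Types (C D E F O : {set 'I_n}) (g h : 'S_n).

Definition stable D : Prop := forall h x, h \in H -> (h x \in D) = (x \in D).

(** [H] restricted to [D] is the direct product of its restrictions to [E] and
    to [D :\: E]. *)
Definition separable D E : Prop := forall h, h \in H -> exists g,
  [/\ g \in H, {in E, g =1 h} & forall x, x \in D -> x \notin E -> g x = x].

(** The empty set counts as an atom, so that labels carried by no point need no special
    treatment. *)
Definition separable_atom D C : Prop :=
  separable D C /\
  forall E, stable E -> E \subset C -> separable D E -> E = set0 \/ E = C.

Lemma stableI D E : stable D -> stable E -> stable (D :&: E).
Proof. by move=> hD hE h x hH; rewrite !inE hD ?hE. Qed.

Lemma stableU D E : stable D -> stable E -> stable (D :|: E).
Proof. by move=> hD hE h x hH; rewrite !inE hD ?hE. Qed.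

Lemma stableD D E : stable D -> stable E -> stable (D :\: E).
Proof. by move=> hD hE h x hH; rewrite !inE hD ?hE. Qed.

Lemma stable0 : stable set0. Proof. by move=> h x _; rewrite !inE. Qed.

Lemma stable_bigcup I (r : seq I) (P : pred I) (F : I -> {set 'I_n}) :
  (forall i, P i -> stable (F i)) -> stable (\bigcup_(i <- r | P i) F i).
Proof. by apply: big_ind; [exact: stable0 | exact: stableU]. Qed.

Lemma stable_orbit x : stable (orbit 'P H x).
Proof.
move=> h y hH; have -> : h y = 'P%act y h by [].
exact: orbit_actr.
Qed.

Lemma separable0 D : separable D set0.
Proof.
by move=> h hH; exists 1; split=> // x; rewrite ?inE // perm1.
Qed.

(** The two projections are composed: the [F]-part of the [E]-part of [h]. *)
Lemma separableI D E F : separable D E -> separable D F -> separable D (E :&: F).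
Proof.
move=> sE sF h /sE[e [/sF[f [fH ff f1] ee e1]]].
exists f; split=> // x; first by rewrite inE => /andP[xE xF]; rewrite ff ?ee.
move=> xD; rewrite inE; case: (boolP (x \in F)) => xF; last by rewrite f1.
by rewrite andbT => xE; rewrite ff ?e1.
Qed.

(** Dividing [h] by its [E]-part leaves its part on the complement. *)
Lemma separableC D E : stable E -> separable D E -> separable D (D :\: E).
Proof.
move=> stE sE h hH; have [e [eH ee e1]] := sE h hH.
exists (e^-1 * h); split; first by rewrite groupM ?groupV.
  move=> x; rewrite inE => /andP[xE xD].
  by rewrite permM -{1}(e1 x) // permK.
move=> x xD; rewrite inE xD andbT negbK => xE.
by rewrite permM -ee ?permKV // stE ?groupV.
Qed.

Lemma separableU D E F : E \subset D -> F \subset D -> stable D ->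
  stable E -> stable F ->
  separable D E -> separable D F -> separable D (E :|: F).
Proof.
move=> ED FD stD stE stF sE sF.
have -> : E :|: F = D :\: ((D :\: E) :&: (D :\: F)).
  apply/setP => x; rewrite !inE.
  have := subsetP ED x; have := subsetP FD x.
  by case: (x \in E) => /=; case: (x \in F) => //=; case: (x \in D) => //= h1 h2;
    first [have := h1 isT | have := h2 isT].
apply: separableC; first by apply: stableI; exact: stableD.
by apply: separableI; exact: separableC.
Qed.

Lemma separable_bigcup D (I : eqType) (r : seq I) (P : pred I) (F : I -> {set 'I_n}) :
  stable D ->
  (forall i, P i -> [/\ F i \subset D, stable (F i) & separable D (F i)]) ->
  separable D (\bigcup_(i <- r | P i) F i).
Proof.
move=> stD hF.
suff [] : [/\ \bigcup_(i <- r | P i) F i \subset D,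
  stable (\bigcup_(i <- r | P i) F i) & separable D (\bigcup_(i <- r | P i) F i)] by [].
apply: (big_ind (fun E => [/\ E \subset D, stable E & separable D E])) => //.
- by split; [exact: sub0set | exact: stable0 | exact: separable0].
- move=> E E' [ED stE sE] [ED' stE' sE'].
  by split; [rewrite subUset ED | exact: stableU | exact: separableU].
Qed.

Lemma separable_sub D D' E : D \subset D' -> separable D' E -> separable D E.
Proof.
move=> /subsetP DD' s h /s[g [gH ge g1]]; exists g; split=> // x /DD'.
exact: g1.
Qed.

(** The element that isolates [E] inside [D] may move points of [D'] outside [D]; its [C]-part in
    [D'] no longer does, and it still fixes [C :\: E]. *)
Lemma separable_trans D D' C E : C \subset D -> E \subset C ->
  separable D E -> separable D' C -> separable D' E.
Proof.
move=> /subsetP CD /subsetP EC sE sC h /sE[e [/sC[c [cH cc c1]] ee e1]].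
exists c; split=> // x; first by move=> xE; rewrite cc ?ee ?EC.
move=> xD' xE; case: (boolP (x \in C)) => xC; last exact: c1.
by rewrite cc // e1 // CD.
Qed.

Lemma atom_extend D D' C : D \subset D' -> separable_atom D C ->
  separable D' C -> separable_atom D' C.
Proof.
move=> DD' [_ h] s; split=> // E stE EC sE; apply: h => //.
exact: separable_sub sE.
Qed.

(** The merged set is the complement of the surviving atoms in the new domain, hence separable. For
    minimality, a stable [E] contains the orbit of [x] or misses it; in the first case the argument
    for the second applies to the rest of the merged set. *)
Lemma atom_merge (I : finType) (F : I -> {set 'I_n}) (ok : pred I) D x :
  stable D -> D = \bigcup_i F i ->
  (forall i j, i != j -> [disjoint F i & F j]) ->
  (forall i, stable (F i)) -> (forall i, separable_atom D (F i)) ->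
  x \notin D ->
  (forall i, reflect (separable (D :|: orbit 'P H x) (F i)) (ok i)) ->
  separable_atom (D :|: orbit 'P H x)
    (orbit 'P H x :|: \bigcup_(i | ~~ ok i) F i).
Proof.
set O := orbit 'P H x; set D' := D :|: O; set C := _ :|: _.
move=> stD DF dF stF aF xD okP.
have stO : stable O := stable_orbit x.
have stD' : stable D' by exact: stableU.
have stC : stable C by apply: stableU => //; apply: stable_bigcup.
have FD i : F i \subset D by rewrite DF; exact: bigcup_sup.
have DD' : D \subset D' by exact: subsetUl.
have DO y : y \in O -> y \notin D.
  by case/orbitP => h hH <-; rewrite -[_ \in D]/(h x \in D) stD.
have CE : C = D' :\: \bigcup_(i | ok i) F i.
  apply/setP => y; rewrite !inE.
  case: (boolP (y \in O)) => yO /=.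
    rewrite orbT andbT; apply/esym; apply: contra (DO _ yO) => /bigcupP[i _].
    exact/subsetP/FD.
  rewrite orbF; apply/bigcupP/andP => [[i ni yi]|[ny]].
    split; last exact: subsetP yi.
    apply/bigcupP => -[j oj yj]; case: (eqVneq i j) => [ij|/dF].
      by rewrite ij oj in ni.
    by move/disjointFr/(_ yi); rewrite yj.
  rewrite {1}DF => /bigcupP[i _ yi]; exists i => //; apply: contra ny => oi.
  by apply/bigcupP; exists i.
have sC : separable D' C.
  rewrite CE; apply: separableC; first by apply: stable_bigcup.
  apply: separable_bigcup => // i /okP s; split=> //.
  exact: subset_trans (FD i) DD'.
(* A point of [E] lies in a failing [F i], which as an atom of [D] is then contained in [E];
   [separable_trans] through [E] would make this [F i] separable in [D']. *)
have key E : stable E -> E \subset C -> separable D' E -> [disjoint E & O] -> E = set0.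
  move=> stE EC sE dE; apply/eqP; rewrite -subset0; apply/subsetP => y yE.
  have := subsetP EC _ yE; rewrite inE (disjointFr dE yE) /= => /bigcupP[i ni yi].
  have sEi : separable D (E :&: F i).
    apply: separableI; last by case: (aF i).
    exact: separable_sub sE.
  have [e|e] := proj2 (aF i) _ (stableI stE (stF i)) (subsetIr _ _) sEi.
    by rewrite -e inE yE.
  case/okP: ni; apply: (separable_trans (D := D) (C := E)) => //.
  - apply/subsetP => z zE; have := subsetP EC _ zE.
    by rewrite inE (disjointFr dE zE) DF => /bigcupP[j _ zj]; apply/bigcupP; exists j.
  - by rewrite -e subsetIl.
  - by case: (aF i).
split=> // E stE EC sE.
case: (boolP (x \in E)) => xE; last first.
  left; apply: key => //; rewrite disjoint_sym; apply/pred0P => y /=.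
  apply/negP => /andP[/orbitP[h hH <-]].
  by rewrite -[_ \in E]/(h x \in E) stE // (negPf xE).
right; apply/eqP; rewrite eqEsubset EC -setD_eq0; apply/eqP; apply: key.
- exact: stableD.
- exact: subsetDl.
- have -> : C :\: E = C :&: (D' :\: E).
    rewrite setIDA; congr (_ :\: E); apply/esym/setIidPl.
    by rewrite CE subsetDl.
  by apply: separableI => //; exact: separableC.
- rewrite disjoint_sym; apply/pred0P => y /=.
  apply/negP => /andP[/orbitP[h hH <-]].
  by rewrite inE -[_ \in E]/(h x \in E) stE // xE.
Qed.

End Separable.

(** * Separable sets and restrictions of the group *)

Section Finest.
Local Open Scope group_scope.
Variables (n : nat) (H : {group 'S_n}).
Implicit Types (C D E F O : {set 'I_n}) (g h : 'S_n).

Lemma stable_astabs D : stable H D -> H \subset 'N(D | 'P).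
Proof. by move=> st; apply/subsetP => h hH; apply/astabsP => x; exact: st. Qed.

Lemma restr_stableE D h x : stable H D -> h \in H ->
  restr_perm D h x = if x \in D then h x else x.
Proof.
move=> st hH; case: ifP => xD; last by rewrite (out_perm (restr_perm_on D h)) ?xD.
by rewrite restr_permE ?(subsetP (stable_astabs st)).
Qed.

(** The restriction of [h] to [C] is also the restriction to [D] of some [g] in [H] exactly when [g]
    agrees with [h] on [C] and fixes the rest of [D]. This turns separability into a membership
    test. *)
Lemma separableE D C : stable H D -> stable H C -> C \subset D ->
  (restr_perm C @* H \subset restr_perm D @* H) <-> separable H D C.
Proof.
move=> stD stC CD; have ND := stable_astabs stD; have NC := stable_astabs stC.
split=> [sub h hH|s].
  have /morphimP[g gN gH e] : restr_perm C h \in restr_perm D @* H.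
    by apply: (subsetP sub); apply: mem_morphim => //; exact: (subsetP NC).
  exists g; split=> // x.
    move=> xC; have := congr1 (fun p : 'S_n => p x) e.
    by rewrite !restr_stableE // xC (subsetP CD).
  move=> xD xC; have := congr1 (fun p : 'S_n => p x) e.
  by rewrite !restr_stableE // xD (negPf xC).
apply/subsetP => _ /morphimP[h _ hH ->]; have [g [gH gC g1]] := s h hH.
have e : restr_perm C h = restr_perm D g.
  apply/permP => x; rewrite !restr_stableE //; case: ifP => xC.
    by rewrite (subsetP CD) // gC.
  by case: ifP => // xD; rewrite g1 ?xC.
by rewrite /= e; apply: mem_morphim => //; exact: (subsetP ND).
Qed.

Lemma stable_psupp : stable H (psupp H).
Proof.
have imp h x : h \in H -> x \in psupp H -> h x \in psupp H.
  move=> hH; rewrite !inE => /existsP[g /andP[gH gx]].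
  apply/existsP; exists (g ^ h); rewrite groupJ //=.
  by rewrite permJ (inj_eq perm_inj).
move=> h x hH; apply/idP/idP; last exact: imp.
by move/(imp _ _ (groupVr hH)); rewrite permK.
Qed.

Lemma restr_psupp h : h \in H -> restr_perm (psupp H) h = h.
Proof.
move=> hH; apply/permP => x; rewrite restr_stableE //; last exact: stable_psupp.
case: ifP => //; rewrite inE => /negbT/existsPn/(_ h).
by rewrite hH negbK => /eqP.
Qed.

(** On the whole support restriction changes nothing, so the parts of [h] are themselves elements of
    [H]. *)
Lemma separable_restr C h : stable H C -> C \subset psupp H ->
  separable H (psupp H) C -> h \in H -> restr_perm C h \in H.
Proof.
move=> stC CH /(separableE stable_psupp stC CH) /subsetP sub hH.
have /sub/morphimP[g _ gH ->] : restr_perm C h \in restr_perm C @* H.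
  by apply: mem_morphim => //; exact: (subsetP (stable_astabs stC)).
by rewrite /= restr_psupp.
Qed.

Lemma restrictionE D : gval (restriction H D) = restr_perm D @* H.
Proof. by []. Qed.

Lemma restr_permU C D h : stable H C -> stable H D -> [disjoint C & D] ->
  h \in H -> restr_perm (C :|: D) h = restr_perm C h * restr_perm D h.
Proof.
move=> stC stD dCD hH; apply/permP => x; rewrite permM !restr_stableE //.
  rewrite inE; case: (boolP (x \in C)) => xC /=.
  + by rewrite ifN // stD // (disjointFr dCD xC).
  + by [].
exact: stableU.
Qed.

Lemma restr_dprod (Ds : seq {set 'I_n}) :
  (forall D, D \in Ds -> stable H D) ->
  (forall D, D \in Ds -> forall h, h \in H -> restr_perm D h \in H) ->
  pairwise (fun C D => [disjoint C & D]) Ds ->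
  \big[dprod/1]_(K <- [seq restriction H D | D <- Ds]) K =
  restriction H (\bigcup_(D <- Ds) D).
Proof.
elim: Ds => [|D Ds IH] st sH /=.
  move=> _; rewrite !big_nil restrictionE; apply/esym/trivgP/subsetP.
  move=> _ /morphimP[h _ hH ->]; rewrite inE; apply/eqP/permP => x.
  by rewrite restr_stableE ?inE ?perm1 //; exact: stable0.
move=> /andP[/allP dD pD]; rewrite !big_cons IH //; last first.
- by move=> C CDs; apply: sH; rewrite inE CDs orbT.
- by move=> C CDs; apply: st; rewrite inE CDs orbT.
set U := \bigcup_(C <- Ds) C.
have stD : stable H D by apply: st; rewrite mem_head.
have stU : stable H U.
  rewrite /U big_seq; apply: stable_bigcup => C CDs.
  by apply: st; rewrite inE CDs orbT.
have dDU : [disjoint D & U].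
  rewrite /U; elim: (Ds) dD => [|C Cs IH'] h; first by rewrite big_nil -setI_eq0 setI0.
  rewrite big_cons -setI_eq0 setIUr setU_eq0 !setI_eq0 h ?mem_head //=.
  by apply: IH' => E ECs; apply: h; rewrite inE ECs orbT.
have sD h : h \in H -> restr_perm D h \in H by apply: sH; rewrite mem_head.
rewrite !restrictionE dprodE; last 2 first.
- apply/centsP => _ /morphimP[g _ gH ->] _ /morphimP[h _ hH ->].
  apply/permP => x; rewrite !permM !restr_stableE //.
  case: (boolP (x \in D)) => xD.
    by rewrite stU // (disjointFr dDU xD) xD.
  by case: (boolP (x \in U)) => xU; rewrite ?stD // (negPf xD).
- apply/trivgP/subsetP => y; rewrite inE => /andP[].
  move=> /morphimP[g _ gH ->] /morphimP[h _ hH e].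
  rewrite inE; apply/eqP/permP => x; rewrite perm1.
  have := congr1 (fun p : 'S_n => p x) e; rewrite !restr_stableE //.
  by case: ifP => // xD; rewrite (disjointFr dDU xD).
have stDU := stableU stD stU.
apply/eqP; rewrite eqEsubset; apply/andP; split; last first.
  apply/subsetP => _ /morphimP[h _ hH ->]; rewrite /= restr_permU //.
  apply: mem_mulg; apply: mem_morphim => //.
  + exact: subsetP (stable_astabs stD) _ hH.
  + exact: subsetP (stable_astabs stU) _ hH.
apply/subsetP => _ /mulsgP[_ _ /morphimP[g _ gH ->] /morphimP[h _ hH ->] ->].
(* The part of [h] outside [D]; it belongs to [H] because [restr_perm D h] does. *)
have fE x : ((restr_perm D h)^-1 * h) x = if x \in D then x else h x.
  rewrite permM; set y := _ x; have -> : x = restr_perm D h y by rewrite permKV.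
  rewrite restr_stableE //; case: (boolP (y \in D)) => yD; first by rewrite stD // yD.
  by rewrite (negPf yD).
(* The action of [g] on [D] and that of [h] off [D] are combined into a single element of [H]. *)
have -> : restr_perm D g * restr_perm U h =
    restr_perm (D :|: U) (restr_perm D g * ((restr_perm D h)^-1 * h)).
  apply/permP => x; rewrite restr_stableE ?groupM ?groupV ?sD //.
  rewrite permM [in RHS]permM fE inE !restr_stableE //.
  case: (boolP (x \in D)) => xD /=.
    by rewrite stD // xD stU // (disjointFr dDU xD).
  by rewrite (negPf xD).
apply: mem_morphim; last by rewrite ?groupM ?groupV ?sD.
by apply: subsetP (stable_astabs stDU) _ _; rewrite ?groupM ?groupV ?sD.
Qed.

Lemma out_psupp (K : {group 'S_n}) k x : k \in K -> x \notin psupp K -> k x = x.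
Proof.
move=> kK; rewrite inE => /existsPn/(_ k).
by rewrite kK negbK => /eqP.
Qed.

Lemma psupp0 (K : {group 'S_n}) : psupp K = set0 -> K :=: 1.
Proof.
move=> K0; apply/trivgP/subsetP => k kK; rewrite inE; apply/eqP/permP => x.
by rewrite perm1 (out_psupp kK) // K0 inE.
Qed.

Lemma psuppS (K L : {group 'S_n}) : K \subset L -> psupp K \subset psupp L.
Proof.
move=> /subsetP KL; apply/subsetP => x; rewrite !inE => /existsP[k /andP[kK kx]].
by apply/existsP; exists k; rewrite KL.
Qed.

Lemma psupp_restriction D : stable H D -> psupp (restriction H D) \subset D.
Proof.
move=> stD; apply/subsetP => x; rewrite inE => /existsP[_ /andP[/morphimP[h _ hH ->]]].
by rewrite /= restr_stableE //; case: ifP => //; rewrite eqxx.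
Qed.

End Finest.

(** * Atoms yield the indecomposable factors *)

Section Atoms.
Local Open Scope group_scope.
Variables (n : nat) (H : {group 'S_n}).

(** The support [E] of a first factor is separable, so it is empty or all of [D]. In the first case
    this factor is trivial; in the second no point is left for the support of the next one. *)
Lemma atom_indecomposable D : stable H D -> D \subset psupp H ->
  separable_atom H (psupp H) D -> ~ ddp_decomposable (restriction H D).
Proof.
move=> stD DH [sD atomD] [Ks [defK dK nK]].
case: Ks dK nK defK => [|K1 [|K2 Ks]] //= /andP[/andP[d12 /allP d1] _] /(_ isT) nt.
rewrite big_cons => /dprodP[[_ Q _ defQ] defK _ _] _.
rewrite defQ in defK.
set K := restriction H D in nt defK.
have KH : K \subset H.
  apply/subsetP => _ /morphimP[h _ hH ->]; exact: separable_restr.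
have K1K : K1 \subset K by rewrite -defK mulG_subl.
have QK : Q \subset K by rewrite -defK mulG_subr.
have /bigdprodWY genQ := defQ.
have K2Q : K2 \subset Q.
  by rewrite -genQ big_cons; exact: subset_trans (subsetUl _ _) (subset_gen _).
pose E := psupp K1.
have QE q x : q \in Q -> x \in E -> q x = x.
  move=> qQ xE; suff QC : Q \subset 'C(E | 'P).
    exact: (astabP (subsetP QC _ qQ)) xE.
  rewrite -genQ gen_subG big_seq.
  apply: (@big_ind _ (fun A : {set 'S_n} => A \subset 'C(E | 'P))).
  - exact: sub0set.
  - by move=> A B subA subB; rewrite subUset subA.
  move=> L Lin; apply/subsetP => l lL; apply/astabP => y yE.
  have dL : [disjoint psupp K1 & psupp L].
    by move: Lin; rewrite inE => /predU1P[->|/d1].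
  by apply: (out_psupp lL); rewrite (disjointFr dL yE).
have ED : E \subset D := subset_trans (psuppS K1K) (psupp_restriction stD).
have stK1 : stable K1 E by exact: stable_psupp.
(* On [D] the element [h] is a product [k * q]; here [k] preserves [E] and [q] fixes it
   pointwise. *)
have split h : h \in H -> exists2 k, k \in K1 & {in E, h =1 k}.
  move=> hH; have : restr_perm D h \in K1 * Q.
    by rewrite defK; apply: mem_morphim => //; exact: subsetP (stable_astabs stD) _ hH.
  case/mulsgP => k q kK1 qQ e; exists k => // x xE.
  have := congr1 (fun p : 'S_n => p x) e.
  rewrite (restr_stableE _ stD hH) (subsetP ED) // permM (QE q) //.
  by rewrite stK1.
have stE : stable H E.
  have imp h x : h \in H -> x \in E -> h x \in E.
    by move=> /split[k kK1 e] xE; rewrite e // stK1.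
  move=> h x hH; apply/idP/idP; last exact: imp.
  by move/(imp _ _ (groupVr hH)); rewrite permK.
have sE : separable H (psupp H) E.
  move=> h /split[k kK1 e]; exists k; split; last by move=> x _; exact: out_psupp.
    exact: subsetP KH _ (subsetP K1K _ kK1).
  by move=> x xE; rewrite e.
have [E0|EDq] := atomD _ stE ED sE.
  by have /eqP[] := nt K1 (mem_head _ _); exact: psupp0.
have /eqP[] := nt K2 (mem_behead (s := [:: K1, K2 & Ks]) (mem_head _ _)).
apply: psupp0; apply/eqP; rewrite -subset0; apply/subsetP => x x2.
have xD : x \in D.
  apply: subsetP (psupp_restriction stD) _ _.
  exact: subsetP (psuppS (subset_trans K2Q QK)) _ x2.
by rewrite -EDq in xD; rewrite (disjointFr d12 xD) in x2.
Qed.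

Lemma finest_of_atoms (Ds : seq {set 'I_n}) :
  (forall D, D \in Ds -> [/\ stable H D, D != set0 & separable_atom H (psupp H) D]) ->
  pairwise (fun C D : {set 'I_n} => [disjoint C & D]) Ds ->
  \bigcup_(D <- Ds) D = psupp H ->
  finest_ddp_decomposition H [seq restriction H D | D <- Ds].
Proof.
move=> hD pD UD.
have DH D : D \in Ds -> D \subset psupp H.
  by move=> Din; rewrite -UD (big_rem D) //= subsetUl.
split; last first.
  move=> _ /mapP[D Din ->]; case: (hD D Din) => stD _ at_.
  by apply: atom_indecomposable => //; exact: DH.
split.
- rewrite restr_dprod //; last 2 first.
  + by move=> D /hD[].
  + move=> D Din h hH; case: (hD D Din) => stD _ [sD _].
    by apply: separable_restr => //; exact: DH.
  rewrite UD restrictionE; apply/setP => x; apply/morphimP/idP => [[h _ hH ->]|xH].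
    by rewrite /= restr_psupp.
  exists x => //=; last by rewrite restr_psupp.
  exact: subsetP (stable_astabs (@stable_psupp _ H)) _ xH.
- rewrite pairwise_map.
  apply: (sub_in_pairwise (P := mem Ds)) (allss Ds) pD => C D Cin Din /= dCD.
  have [stC _ _] := hD _ Cin; have [stD _ _] := hD _ Din.
  apply: disjointW dCD; exact: psupp_restriction.
- move=> _ _ /mapP[D Din ->]; have [stD D0 _] := hD _ Din.
  case/set0Pn: D0 => x xD; have := subsetP (DH _ Din) _ xD.
  rewrite inE => /existsP[h /andP[hH]]; apply: contraNneq => /= K1.
  have : restr_perm D h \in restr_perm D @* H.
    by apply: mem_morphim => //; exact: subsetP (stable_astabs stD) _ hH.
  rewrite K1 inE => /eqP /(congr1 (fun p : 'S_n => p x)).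
  by rewrite (restr_stableE _ stD hH) xD perm1 => ->.
Qed.
End Atoms.

(** * Partitions into atoms, stored as labels of points *)

Section Labels.
Variables (n : nat) (H : {group 'S_n}) (orb : 'I_n -> 'I_n).
Implicit Types (cl : 'I_n -> nat) (x y c i : 'I_n) (h : 'S_n).

Hypothesis orb_in : forall x, orb x \in orbit 'P H x.
Hypothesis orb_inv : forall h x, h \in H -> orb (h x) = orb x.

Lemma mem_orbit_eq x y : (y \in orbit 'P H x) = (orb y == orb x).
Proof.
apply/idP/eqP => [/orbitP[h hH <-]|e]; first exact: orb_inv.
by rewrite -(orbit_eqP (orb_in x)) -e (orbit_eqP (orb_in y)) orbit_refl.
Qed.

Lemma orb_idem x : orb (orb x) = orb x.
Proof. by apply/eqP; rewrite -mem_orbit_eq. Qed.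

Lemma psupp_orb x : (orb x \in psupp H) = (x \in psupp H).
Proof. by case/orbitP: (orb_in x) => h hH <-; rewrite stable_psupp. Qed.

Definition cell cl (c : nat) : {set 'I_n} := [set x | cl x == c].
Definition domain cl : {set 'I_n} := [set x | cl x < n].

Lemma domainE cl : domain cl = \bigcup_(c : 'I_n) cell cl c.
Proof.
apply/setP => x; rewrite inE; apply/idP/bigcupP => [lt|[c _]].
  by exists (Ordinal lt) => //; rewrite inE.
by rewrite inE => /eqP->.
Qed.

Lemma disjoint_cell cl c c' : c != c' -> [disjoint cell cl c & cell cl c'].
Proof.
move=> ne; apply/pred0P => x /=; rewrite !inE; apply/negP => /andP[/eqP->].
by rewrite val_eqE (negPf ne).
Qed.

(** The orbits with a representative below [i] have been processed; [n] labels
    the points of the others. *)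
Definition labelling (i : nat) cl : Prop :=
  [/\ forall x, (cl x < n) = (x \in psupp H) && (orb x < i),
      forall x, cl x <= n,
      forall c, stable H (cell cl c) /\ separable_atom H (domain cl) (cell cl c) &
      forall x c, cl x = c -> cl c = c].

Lemma atom0 D : separable_atom H D set0.
Proof.
split; first exact: separable0.
by move=> E _; rewrite subset0 => /eqP->; left.
Qed.

Lemma labelling0 : labelling 0 (fun=> n).
Proof.
split=> // [x|c]; first by rewrite ltnn andbF.
have -> : cell (fun=> n) c = set0.
  by apply/setP => x; rewrite !inE gtn_eqF.
by split; [exact: stable0 | exact: atom0].
Qed.

Lemma labelling_skip cl i : ~~ ((i \in psupp H) && (orb i == i)) ->
  labelling i cl -> labelling i.+1 cl.
Proof.
move=> ni [h1 h2 h3 h4]; split=> // x; rewrite h1; apply: andb_id2l => xH.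
suff ne : orb x != i :> nat by lia.
apply: contra ni => /eqP/val_inj <-; by rewrite orb_idem eqxx psupp_orb xH.
Qed.

(** The cells that fail take over the label [i] of the new orbit, and their old labels keep empty
    cells. The other cells are unchanged and stay atoms by [atom_extend]. *)
Lemma labelling_step cl cl' i (ok : nat -> bool) :
  i \in psupp H -> orb i = i -> labelling i cl ->
  (forall c, reflect (separable H (domain cl :|: orbit 'P H i) (cell cl c)) (ok c)) ->
  (forall y, cl' y = if orb y == i then i : nat else
             if (cl y < n) && ~~ ok (cl y) then i : nat else cl y) ->
  labelling i.+1 cl'.
Proof.
move=> iH oi [h1 h2 h3 h4] okP clE.
have OE y : (y \in orbit 'P H i) = (orb y == i) by rewrite mem_orbit_eq oi.
have cl'lt y : (cl' y < n) = (orb y == i) || (cl y < n).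
  rewrite clE; case: eqP => _ /=; first exact: ltn_ord.
  by case: (boolP (cl y < n)) => /= [lt|/negPf->] //; case: ifP; rewrite ?ltn_ord ?lt.
have domE : domain cl' = domain cl :|: orbit 'P H i.
  by apply/setP => y; rewrite inE cl'lt inE OE orbC inE.
have iD : i \notin domain cl by rewrite inE h1 oi ltnn andbF.
(* A label in use is its own label, so [i] would already belong to the domain. *)
have nocl y : cl y != i.
  apply: contra iD => /eqP e; rewrite inE.
  by rewrite (h4 y i e).
have notO y : cl y < n -> orb y != i.
  by rewrite h1 => /andP[_ lt]; rewrite -val_eqE ltn_eqF.
have celli : cell cl' i = orbit 'P H i :|: \bigcup_(c : 'I_n | ~~ ok c) cell cl c.
  apply/setP => y; rewrite !inE OE clE; case: (eqVneq (orb y) i) => [_|ne] /=.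
    by rewrite eqxx.
  case: ifP => [/andP[lt nok]|h].
    rewrite eqxx; apply/esym/bigcupP; exists (Ordinal lt) => //.
    by rewrite inE.
  rewrite (negPf (nocl y)); apply/esym/negP => /bigcupP[c nc].
  by rewrite inE => /eqP e; move: h; rewrite e ltn_ord nc.
have cellc c : c != i -> cell cl' c = if ok c then cell cl c else set0.
  move=> ci; apply/setP => y; rewrite [LHS]inE clE.
  have ic : (i == c :> nat) = false by rewrite val_eqE eq_sym (negPf ci).
  case: (eqVneq (orb y) i) => [e|ne].
    rewrite ic; case: ifP => _; rewrite inE //.
    apply/esym/negP => /eqP e'; have := notO y; rewrite e' e eqxx => /(_ (ltn_ord c)).
    by [].
  case: (boolP (ok c)) => oc; rewrite inE.
    case: ifP => // /andP[_ nok]; rewrite ic; apply/esym/negP => /eqP e.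
    by rewrite e oc in nok.
  case: ifP => [|h]; first by rewrite ic.
  by apply/negP => /eqP e; move: h; rewrite e ltn_ord oc.
have stc c : stable H (cell cl c) by case: (h3 c).
have atc c : separable_atom H (domain cl) (cell cl c) by case: (h3 c).
split.
- move=> y; rewrite cl'lt h1; case: (eqVneq (orb y) i) => [e|ne] /=.
    by rewrite -(psupp_orb y) e iH ltnSn.
  congr (_ && _); rewrite -val_eqE /= in ne; lia.
- move=> y; rewrite clE; do 2?case: ifP => _ //; exact: ltnW.
- move=> c; rewrite domE; case: (eqVneq c i) => [->|ci].
    rewrite celli; split.
      apply: stableU; first exact: stable_orbit.
      by apply: stable_bigcup => c' _.
    apply: atom_merge => //.
    + by rewrite domainE; apply: stable_bigcup => c' _.
    + exact: domainE.
    + exact: disjoint_cell.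
  rewrite cellc //; case: okP => sc; last by split; [exact: stable0 | exact: atom0].
  split=> //; apply: (atom_extend (D := domain cl)) => //; exact: subsetUl.
- move=> y c; rewrite !clE; case: eqP => [_ /val_inj <-|ne].
    by rewrite oi eqxx.
  case: ifP => [_ /val_inj <-|h e]; first by rewrite oi eqxx.
  have clc := h4 _ _ e; rewrite clc ltn_ord /=.
  have := notO c; rewrite clc ltn_ord => /(_ isT) /negPf ->.
  by rewrite e ltn_ord /= in h; rewrite h.
Qed.

Section Final.
Variable cl : 'I_n -> nat.
Hypothesis cl_final : labelling n cl.

(** A nonempty cell contains the point that is its label, so it is listed exactly once; the label
    [n] of the fixed points is not a point and is skipped. *)
Definition cell_reps : seq 'I_n := [seq c <- enum 'I_n | cl c == c].
Definition orbit_reps (c : 'I_n) : seq 'I_n :=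
  [seq i <- enum 'I_n | (cl i == c) && (orb i == i)].
Definition partition_list : seq (seq {set 'I_n}) :=
  [seq [seq orbit 'P H i | i <- orbit_reps c] | c <- cell_reps].

Lemma domain_final : domain cl = psupp H.
Proof.
by case: cl_final => h1 _ _ _; apply/setP => x; rewrite inE h1 ltn_ord andbT.
Qed.

Lemma cell_orb x c : cl x = c -> cl (orb x) = c.
Proof.
move=> e; case: cl_final => _ _ h3 _; have [st _] := h3 c.
case/orbitP: (orb_in x) => h hH <-; have := st h x hH.
by rewrite !inE e eqxx => /eqP.
Qed.

Lemma orbit_reps_orb x c : cl x = c -> orb x \in orbit_reps c.
Proof.
by move=> e; rewrite mem_filter mem_enum andbT orb_idem (cell_orb e) !eqxx.
Qed.

Lemma cell_repsP x : x \in psupp H -> exists2 c, c \in cell_reps & cl x = c.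
Proof.
rewrite -domain_final inE => lt; exists (Ordinal lt) => //.
case: cl_final => _ _ _ h4.
by rewrite mem_filter mem_enum andbT (h4 x (Ordinal lt)).
Qed.

Lemma uniq_flatten_orbits (cs : seq 'I_n) : uniq cs ->
  uniq (flatten [seq orbit_reps c | c <- cs]).
Proof.
elim: cs => //= c cs IH /andP[ncs /IH u]; rewrite cat_uniq u andbT.
rewrite filter_uniq ?enum_uniq //=; apply/hasPn => i /flattenP[_ /mapP[c' c'in ->]].
rewrite !mem_filter => /andP[/andP[/eqP e _] _]; rewrite e val_eqE.
by apply/negP => /andP[/andP[/eqP cc _] _]; rewrite -cc c'in in ncs.
Qed.

Lemma flatten_partition_list : flatten partition_list =
  [seq orbit 'P H i | i <- flatten [seq orbit_reps c | c <- cell_reps]].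
Proof. by rewrite map_flatten -map_comp. Qed.

Lemma orbit_card_gt1 x : (1 < #|orbit 'P H x|) = (x \in psupp H).
Proof.
rewrite ltnNge; apply/negP/idP => [h|].
  apply/negPn/negP => xH; apply: h; rewrite -(cards1 x) subset_leq_card //.
  by apply/subsetP => _ /orbitP[h hH <-]; rewrite inE /= apermE (out_psupp hH xH).
rewrite inE => /existsP[h /andP[hH hx]] le.
have : [set x; h x] \subset orbit 'P H x.
  apply/subsetP => y; rewrite !inE => /orP[]/eqP->; first exact: orbit_refl.
  exact: (mem_orbit 'P x hH).
by move/subset_leq_card; rewrite cards2 eq_sym hx leqNgt ltnS le.
Qed.

Lemma partition_list_ok : lists_orbit_partition H partition_list.
Proof.
have repsE i : i \in flatten [seq orbit_reps c | c <- cell_reps] ->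
    orb i = i /\ i \in psupp H.
  move=> /flattenP[_ /mapP[c _ ->]].
  rewrite mem_filter => /andP[/andP[/eqP e /eqP oi] _].
  by split=> //; rewrite -domain_final inE e ltn_ord.
split.
- rewrite flatten_partition_list map_inj_in_uniq.
    by apply: uniq_flatten_orbits; rewrite filter_uniq // enum_uniq.
  move=> i j /repsE[oi _] /repsE[oj _] e.
  have := orbit_refl 'P H i; rewrite e mem_orbit_eq oi oj => /eqP.
  by [].
- move=> O; rewrite flatten_partition_list inE; apply/mapP/andP.
    move=> [i /repsE[_ iH] ->]; split; last by rewrite orbit_card_gt1.
    by apply/imsetP; exists i.
  move=> [/imsetP[x _ ->]]; rewrite orbit_card_gt1 => xH.
  have [c cin e] := cell_repsP xH.
  exists (orb x); last by apply/esym/orbit_eqP; exact: orb_in.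
  by apply/flattenP; exists (orbit_reps c); [exact: map_f | exact: orbit_reps_orb].
- apply/negP => /mapP[c]; rewrite mem_filter => /andP[/eqP e _].
  by have := orbit_reps_orb e; case: (orbit_reps c).
Qed.

Lemma bigcup_orbits c :
  \bigcup_(O <- [seq orbit 'P H i | i <- orbit_reps c]) O = cell cl c.
Proof.
rewrite big_map; apply/setP => x; rewrite inE.
have -> : (x \in \bigcup_(i <- orbit_reps c) orbit 'P H i) =
    has (fun i => x \in orbit 'P H i) (orbit_reps c).
  by elim: (orbit_reps c) => [|i r IH]; rewrite ?big_nil ?inE // big_cons inE IH.
apply/hasP/eqP => [[i]|e].
  rewrite mem_filter => /andP[/andP[/eqP e /eqP oi] _] /orbitP[h hH <-].
  case: cl_final => _ _ h3 _; have [st _] := h3 c.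
  by have := st h i hH; rewrite !inE e eqxx => /eqP.
by exists (orb x); [exact: orbit_reps_orb | rewrite mem_orbit_eq orb_idem].
Qed.

Lemma partition_list_finest : finest_ddp_decomposition H (factors H partition_list).
Proof.
case: (cl_final) => h1 h2 h3 h4.
have -> : factors H partition_list =
    [seq restriction H D | D <- [seq cell cl c | c <- cell_reps]].
  rewrite /factors /partition_list -!map_comp; apply: eq_map => c /=.
  by rewrite bigcup_orbits.
apply: finest_of_atoms.
- move=> D /mapP[c]; rewrite mem_filter => /andP[e _] ->; have [st at_] := h3 c.
  split=> //; last by rewrite -domain_final.
  by apply/set0Pn; exists c; rewrite inE.
- rewrite pairwise_map; have : uniq cell_reps by rewrite filter_uniq // enum_uniq.
  rewrite uniq_pairwise; apply: sub_pairwise => c d /=; exact: disjoint_cell.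
- apply/setP => x; rewrite -domain_final big_map inE.
  have -> : (x \in \bigcup_(c <- cell_reps) cell cl c) =
      has (fun c : 'I_n => x \in cell cl c) cell_reps.
    by elim: cell_reps => [|i r IH]; rewrite ?big_nil ?inE // big_cons inE IH.
  apply/hasP/idP => [[c _]|lt]; first by rewrite inE => /eqP->.
  have xH : x \in psupp H by rewrite -domain_final inE.
  by have [c cin e] := cell_repsP xH; exists c => //; rewrite inE e.
Qed.

End Final.
End Labels.

(** * Loop rules *)

Fixpoint writes (c : stmt) : seq nat :=
  match c with
  | SSkip | SWrite _ => [::]
  | SSet a _ _ _ _ | SRead a _ _ _ => [:: a]
  | SSeq c1 c2 | SIf _ c1 c2 => writes c1 ++ writes c2
  | SFor a _ c => a :: writes c
  end.

Fixpoint silent (c : stmt) : bool :=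
  match c with
  | SWrite _ => false
  | SSeq c1 c2 | SIf _ c1 c2 => silent c1 && silent c2
  | SFor _ _ c => silent c
  | _ => true
  end.

Section Loops.
Variables n m : nat.
Implicit Types (c : stmt) (s : lstate).

(** For a concrete program the side condition is settled by computation, so untouched arrays need no
    loop invariant. *)
Lemma sem_frame c s b i j k : b \notin writes c ->
  lmem (sem n m c s) b i j k = lmem s b i j k.
Proof.
elim: c s => [|a e1 e2 e3 e|a e1 e2 e3|e|c1 IH1 c2 IH2|e c1 IH1 c2 IH2|a e c IH] s //=.
- by rewrite inE => /negPf ba; rewrite /lupd ba.
- by rewrite inE => /negPf ba; rewrite /lupd ba.
- by rewrite mem_cat negb_or => /andP[b1 b2]; rewrite IH2 ?IH1.
- by rewrite mem_cat negb_or => /andP[b1 b2]; case: ifP => _; rewrite ?IH1 ?IH2.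
- rewrite inE negb_or => /andP[/negPf ba bc].
  by move: (iota _ _) => r; elim: r s => //= x r IHr s; rewrite IHr IH //= /lupd ba.
Qed.

Lemma sem_silent c s : silent c -> lout (sem n m c s) = lout s.
Proof.
elim: c s => [|a e1 e2 e3 e|a e1 e2 e3|e|c1 IH1 c2 IH2|e c1 IH1 c2 IH2|a e c IH] s //=.
- by move=> /andP[h1 h2]; rewrite IH2 ?IH1.
- by move=> /andP[h1 h2]; case: ifP => _; rewrite ?IH1 ?IH2.
- by move=> h; move: (iota _ _) => r; elim: r s => //= x r IHr s; rewrite IHr IH.
Qed.

Lemma sem_seq c1 c2 s : sem n m (SSeq c1 c2) s = sem n m c2 (sem n m c1 s).
Proof. by []. Qed.

Lemma sem_ifT e c1 c2 s : eval n m s e != 0 ->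
  sem n m (SIf e c1 c2) s = sem n m c1 s.
Proof. by move=> h; rewrite /= h. Qed.

Lemma sem_ifF e c1 c2 s : eval n m s e = 0 ->
  sem n m (SIf e c1 c2) s = sem n m c2 s.
Proof. by move=> h; rewrite /= h. Qed.

Lemma for_ind v e c s (P : nat -> lstate -> Prop) : P 0 s ->
  (forall i s', i < eval n m s e -> P i s' ->
     P i.+1 (sem n m c (lset s' v 0 0 0 i))) ->
  P (eval n m s e) (sem n m (SFor v e c) s).
Proof.
move=> P0 Pi /=; elim: (eval n m s e) Pi => [|k IH] Pi //.
rewrite -addn1 iotaD foldl_cat add0n addn1 /=; apply: (Pi) => //.
by apply: IH => i s' ik; apply: Pi; exact: ltnW.
Qed.

Lemma for_points v c s (P : nat -> lstate -> Prop) : P 0 s ->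
  (forall (i : 'I_n) s', P i s' -> P i.+1 (sem n m c (lset s' v 0 0 0 i))) ->
  P n (sem n m (SFor v EPoints c) s).
Proof.
move=> P0 Pi; apply: (for_ind (e := EPoints)) => // i s' ik.
exact: (Pi (Ordinal ik)).
Qed.

(** [I s g] says that the memory of [s] represents the abstract value [g]. *)
Lemma for_ghost (G : Type) (I : lstate -> G -> Prop) (R : G -> G -> Prop)
    (Q : 'I_n -> G -> Prop) v c s g :
  (forall x, R x x) -> (forall x y z, R x y -> R y z -> R x z) ->
  (forall i x y, R x y -> Q i x -> Q i y) -> I s g ->
  (forall (i : 'I_n) s' g', I s' g' -> R g g' -> exists g'',
     [/\ I (sem n m c (lset s' v 0 0 0 i)) g'', R g' g'' & Q i g'']) ->
  exists g', [/\ I (sem n m (SFor v EPoints c) s) g', R g g' & forall i, Q i g'].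
Proof.
move=> Rxx Rtr Qmono Ig body.
have [] := @for_points v c s (fun k s' => exists g',
  [/\ I s' g', R g g' & forall i : 'I_n, i < k -> Q i g']).
- by exists g; split.
- move=> i s' [g' [Ig' Rg' Qg']]; have [g'' [Ig'' Rg'' Qg'']] := body i s' g' Ig' Rg'.
  exists g''; split=> //; first exact: Rtr Rg''.
  move=> j; rewrite ltnS leq_eqVlt => /orP[/eqP/val_inj->//|ji].
  exact: Qmono Rg'' (Qg' _ ji).
- by move=> g' [Ig' Rg' Qg']; exists g'; split=> // i; exact: Qg'.
Qed.

(** The rule for loops that fill one row, round [i] storing [f i] at position [h i]. The body may
    rely on the old values at positions not yet reached, which permits updates in place; an [h]
    other than the identity serves to invert a permutation. *)
Lemma for_store v c s a i0 j0 (h : 'I_n -> 'I_n) (f : 'I_n -> nat) :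
  injective h -> a != v ->
  (forall (i : 'I_n) s',
     (forall b i' j' k', b != v -> ~~ [&& b == a, i' == i0 & j' == j0] ->
        lmem s' b i' j' k' = lmem s b i' j' k') ->
     (forall k : 'I_n, i <= k -> lmem s' a i0 j0 (h k) = lmem s a i0 j0 (h k)) ->
     lmem s' v 0 0 0 = i ->
     forall b i' j' k', b != v -> lmem (sem n m c s') b i' j' k' =
       lupd (lmem s') a i0 j0 (h i) (f i) b i' j' k') ->
  (forall k : 'I_n, lmem (sem n m (SFor v EPoints c) s) a i0 j0 (h k) = f k) /\
  (forall b i' j' k', b != v -> ~~ [&& b == a, i' == i0 & j' == j0] ->
     lmem (sem n m (SFor v EPoints c) s) b i' j' k' = lmem s b i' j' k').
Proof.
move=> hI av body.
have := @for_points v c s (fun t s' =>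
  [/\ forall k : 'I_n, k < t -> lmem s' a i0 j0 (h k) = f k,
      forall k : 'I_n, t <= k -> lmem s' a i0 j0 (h k) = lmem s a i0 j0 (h k) &
      forall b i' j' k', b != v -> ~~ [&& b == a, i' == i0 & j' == j0] ->
        lmem s' b i' j' k' = lmem s b i' j' k']).
case=> //; last by move=> h1 _ h2; split=> // k; exact: h1.
move=> i s' [h1 h2 h3].
have vE b i' j' k' : b != v -> lmem (lset s' v 0 0 0 i) b i' j' k' = lmem s' b i' j' k'.
  by move=> /negPf bv; rewrite /= /lupd bv.
have B := body i (lset s' v 0 0 0 i).
have {}B : forall b i' j' k', b != v ->
    lmem (sem n m c (lset s' v 0 0 0 i)) b i' j' k' =
    lupd (lmem s') a i0 j0 (h i) (f i) b i' j' k'.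
  move=> b i' j' k' bv; rewrite B //.
  - by rewrite /lupd; case: ifP => // _; exact: vE.
  - by move=> *; rewrite vE // h3.
  - by move=> k ik; rewrite vE // h2.
  - by rewrite /= /lupd !eqxx.
split.
- move=> k; rewrite ltnS leq_eqVlt B // /lupd !eqxx /= => /orP[/eqP/val_inj->|ki].
    by rewrite eqxx.
  rewrite ifN ?h1 //; apply: contraTneq ki => /val_inj/hI->.
  by rewrite ltnn.
- move=> k ik; rewrite B // /lupd !eqxx /= ifN ?h2 //; first exact: ltnW.
  by apply: contraTneq ik => /val_inj/hI->; rewrite ltnn.
- move=> b i' j' k' bv ba; rewrite B // /lupd ifN ?h3 //.
  by apply: contra ba => /and4P[-> -> ->].
Qed.

End Loops.

(** * The program and its correctness *)

(* One-dimensional arrays use the last index, scalars the entry (0, 0, 0). *)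
Local Notation aGen := 0.
Local Notation aOrb := 1.
Local Notation aMoved := 2.
Local Notation aCell := 3.
Local Notation aTab := 4.
Local Notation aHas := 5.
Local Notation aPerm := 6.
Local Notation aInv := 7.
Local Notation vOk := 8.
Local Notation vFail := 9.
Local Notation vK := 10.
Local Notation vX := 11.
Local Notation vL := 12.
Local Notation vJ := 13.
Local Notation vL1 := 14.
Local Notation vJ1 := 15.
Local Notation vL2 := 16.
Local Notation vJ2 := 17.
Local Notation vR1 := 18.
Local Notation vR2 := 19.
Local Notation vI := 20.
Local Notation vC := 21.
Local Notation vY := 22.
Local Notation vA := 23.
Local Notation vB := 24.
Local Notation vAll := 25.
Local Notation vCnt := 26.

Local Notation zero := (EBool false).
Local Notation one := (EBool true).
Local Notation get1 a k := (EGet a zero zero k).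
Local Notation var v := (EGet v zero zero zero).
Local Notation set1 a k e := (SSet a zero zero k e).
Local Notation setv v e := (SSet v zero zero zero e).

(** The inverse of the table entry [u] is tabulated by storing [k] at [u k], and [aPerm] is then
    composed with it in place. *)
Definition p_divide : stmt :=
  SSeq (SFor vK EPoints (set1 aInv (EGet aTab (var vL) (var vJ) (var vK)) (var vK)))
       (SFor vK EPoints (set1 aPerm (var vK) (get1 aInv (get1 aPerm (var vK))))).

(** After a failure the remaining levels do nothing, so [vFail] and the residue in [aPerm] survive
    for [p_insert]. *)
Definition p_sift_level : stmt :=
  SIf (var vOk)
    (SSeq (setv vJ (get1 aPerm (var vL)))
       (SIf (EGet aHas (var vL) (var vJ) zero) p_divide
          (SSeq (setv vOk zero) (setv vFail (var vL)))))
    SSkip.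

Definition p_sift : stmt := SSeq (setv vOk one) (SFor vL EPoints p_sift_level).

Definition p_insert : stmt :=
  SIf (var vOk) SSkip
    (SSeq (setv vJ (get1 aPerm (var vFail)))
       (SSeq (SSet aHas (var vFail) (var vJ) zero one)
          (SFor vK EPoints
             (SSet aTab (var vFail) (var vJ) (var vK) (get1 aPerm (var vK)))))).

Definition p_reset : stmt :=
  SFor vL EPoints (SFor vJ EPoints
    (SIf (EEq (var vL) (var vJ))
       (SSeq (SSet aHas (var vL) (var vJ) zero one)
          (SFor vK EPoints (SSet aTab (var vL) (var vJ) (var vK) (var vK))))
       (SSet aHas (var vL) (var vJ) zero zero))).

Definition p_product : stmt :=
  SFor vK EPoints (set1 aPerm (var vK)
    (EGet aTab (var vL2) (var vJ2) (EGet aTab (var vL1) (var vJ1) (var vK)))).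

Definition p_pair : stmt :=
  SIf (EGet aHas (var vL1) (var vJ1) zero)
    (SIf (EGet aHas (var vL2) (var vJ2) zero)
       (SSeq p_product (SSeq p_sift p_insert)) SSkip) SSkip.

Definition p_round : stmt :=
  SFor vL1 EPoints (SFor vJ1 EPoints (SFor vL2 EPoints (SFor vJ2 EPoints p_pair))).

(** * Correctness of sifting, insertion and initialisation *)

Section Table.
Variables n m : nat.
Implicit Types (s : lstate) (p q u : 'S_n) (tb : 'I_n -> 'I_n -> option 'S_n).

Definition holds s a i j p : Prop := forall k : 'I_n, lmem s a i j k = p k.

(** An absent entry says nothing about [aTab]: resetting the table clears flags and leaves old
    permutations behind. *)
Definition holds_table s tb : Prop := forall l j : 'I_n,
  if tb l j is Some u then lmem s aHas l j 0 != 0 /\ holds s aTab l j u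
  else lmem s aHas l j 0 = 0.

Lemma holds_table_eq s s' tb :
  (forall i j k, lmem s' aHas i j k = lmem s aHas i j k) ->
  (forall i j k, lmem s' aTab i j k = lmem s aTab i j k) ->
  holds_table s tb -> holds_table s' tb.
Proof.
move=> h1 h2 h l j; have := h l j; case: (tb l j) => [u [h3 h4]|]; rewrite h1 //.
by split=> // k; rewrite h2.
Qed.

Lemma holds_table_lset s tb v i j k x : v \notin [:: aTab; aHas] ->
  holds_table s tb -> holds_table (lset s v i j k x) tb.
Proof.
rewrite !inE negb_or => /andP[/negPf h1 /negPf h2].
by apply: holds_table_eq => i' j' k'; rewrite /= /lupd eq_sym ?h1 ?h2.
Qed.

Lemma holds_table_sem c s tb : aTab \notin writes c -> aHas \notin writes c ->
  holds_table s tb -> holds_table (sem n m c s) tb.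
Proof. by move=> h1 h2; apply: holds_table_eq => i j k; exact: sem_frame. Qed.

Lemma divide_spec s (l j : 'I_n) q u :
  lmem s vL 0 0 0 = l -> lmem s vJ 0 0 0 = j -> holds s aTab l j u ->
  holds s aPerm 0 0 q -> holds (sem n m p_divide s) aPerm 0 0 (q * u^-1)%g.
Proof.
move=> sl sj su sq; rewrite /p_divide sem_seq; set s1 := sem n m (SFor _ _ _) s.
have [] := @for_store n m vK (set1 aInv (EGet aTab (var vL) (var vJ) (var vK)) (var vK))
  s aInv 0 0 u (fun k => k) (@perm_inj _ u) isT.
  move=> i s' fr _ si b i' j' k' bk /=.
  by rewrite si (fr vL) // (fr vJ) // sl sj (fr aTab) // su.
rewrite -/s1 => inv fr1.
have [] := @for_store n m vK (set1 aPerm (var vK) (get1 aInv (get1 aPerm (var vK))))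
  s1 aPerm 0 0 id (fun k => (q * u^-1)%g k) (@inj_id _) isT.
  move=> i s' fr un si b i' j' k' bk /=; rewrite si un // (fr1 aPerm) // sq.
  by rewrite (fr aInv) // -{1}(permKV u (q i)) inv permM.
by move=> h _ k; exact: h.
Qed.

(** On failure, the reduction of [p] to the residue [q] is stated for every larger table, because it
    is used in the table obtained by inserting [q]. *)
Lemma sift_spec (K : {group 'S_n}) s s' tb p :
  transversals tb -> {subset entries tb <= K} -> p \in K ->
  holds_table s tb -> holds s aPerm 0 0 p ->
  s' = sem n m p_sift s ->
  (lmem s' vOk 0 0 0 = 1 /\ sift tb (enum 'I_n) p) \/
  (lmem s' vOk 0 0 0 = 0 /\ exists q (l : 'I_n),
     [/\ lmem s' vFail 0 0 0 = l, holds s' aPerm 0 0 q, q \in K /\ fixes_below l q,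
         tb l (q l) = None &
         forall tb', subtable tb tb' ->
           sift tb' (enum 'I_n) p = sift tb' (drop l (enum 'I_n)) q]).
Proof.
move=> tr sub pK st sp s'E.
pose P k s := holds_table s tb /\
  ((lmem s vOk 0 0 0 = 1 /\ exists q,
     [/\ holds s aPerm 0 0 q, q \in K, fixes_below k q &
         forall tb', subtable tb tb' ->
           sift tb' (enum 'I_n) p = sift tb' (drop k (enum 'I_n)) q]) \/
   (lmem s vOk 0 0 0 = 0 /\ exists q (l : 'I_n),
     [/\ lmem s vFail 0 0 0 = l, holds s aPerm 0 0 q, q \in K /\ fixes_below l q,
         tb l (q l) = None &
         forall tb', subtable tb tb' ->
           sift tb' (enum 'I_n) p = sift tb' (drop l (enum 'I_n)) q])).
have [] : P n s'; last first.
  move=> _ [[ok [q [_ _ fq e]]]|]; [left|by right].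
  by rewrite e // drop_oversize ?size_enum_ord // (fixes_all fq) /= eqxx.
rewrite s'E /p_sift sem_seq; apply: for_points.
  split; first exact: holds_table_lset.
  left; split=> //; exists p; split=> //; last by move=> tb' _; rewrite drop0.
move=> l s1 [st1 h1]; set s2 := lset s1 _ _ _ _ _.
have st2 : holds_table s2 tb by exact: holds_table_lset.
have s2l : lmem s2 vL 0 0 0 = l by [].
split; first exact: holds_table_sem.
have s2ok : eval n m s2 (var vOk) = lmem s1 vOk 0 0 0 by [].
case: h1 => [[ok1 [q [s1q qK fq e]]]|[ok0 h1]]; last first.
  by right; rewrite /p_sift_level sem_ifF // s2ok.
rewrite /p_sift_level sem_ifT; last by rewrite s2ok ok1.
rewrite sem_seq; set s3 := sem n m (setv vJ _) s2.
have s3j : lmem s3 vJ 0 0 0 = q l by rewrite -s1q.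
have s3l : lmem s3 vL 0 0 0 = l by [].
have s3q : holds s3 aPerm 0 0 q by move=> k; rewrite -s1q.
have st3 : holds_table s3 tb by exact: holds_table_lset.
have s3h : eval n m s3 (EGet aHas (var vL) (var vJ) zero) = lmem s3 aHas l (q l) 0.
  by rewrite -s3j -s3l.
have := st3 l (q l); case eu: (tb l (q l)) => [u|] => [[h s3u]|h].
  rewrite sem_ifT; last by rewrite s3h.
  left; split; first by rewrite sem_frame.
  exists (q * u^-1)%g; split.
  - exact: (divide_spec s3l s3j).
  - by rewrite groupM ?groupV //; apply: sub; apply/entriesP; exists l, (q l).
  - exact: fixes_below_step eu.
  - by move=> tb' sb; rewrite e // drop_enum_ord /= (sb _ _ _ eu).
rewrite sem_ifF; last by rewrite s3h.
by right; split=> //; exists q, l; split.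
Qed.

Lemma insert_spec (K : {group 'S_n}) s tb p :
  transversals tb -> {subset entries tb <= K} -> p \in K ->
  holds_table s tb -> holds s aPerm 0 0 p ->
  exists tb', [/\ holds_table (sem n m (SSeq p_sift p_insert) s) tb',
    transversals tb', {subset entries tb' <= K}, subtable tb tb' &
    sift tb' (enum 'I_n) p /\ (sift tb (enum 'I_n) p -> tb' = tb)].
Proof.
move=> tr sub pK st sp; rewrite sem_seq.
have := sift_spec tr sub pK st sp erefl.
have : holds_table (sem n m p_sift s) tb by exact: holds_table_sem.
move: (sem n m p_sift s) => s1 st1 [[ok pass]|[ok [q [l [s1l s1q [qK fq] eN e]]]]].
  by exists tb; split=> //; rewrite /p_insert sem_ifT /= ?ok.
exists (insert tb l q); split.
- rewrite /p_insert sem_ifF // !sem_seq; set s2 := sem n m _ s1; set s3 := sem n m _ s2.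
  have s3l : lmem s3 vFail 0 0 0 = l by rewrite -s1l.
  have s3j : lmem s3 vJ 0 0 0 = q l by rewrite -s1q /s3 /= /lupd /= s1l.
  set c := SSet aTab _ _ _ _.
  have [] := @for_store n m vK c s3 aTab l (q l) id (fun k => q k) (@inj_id _) isT.
    move=> i s' fr un si b i' j' k' bk /=.
    rewrite si (fr vFail) // (fr vJ) // s3l s3j (fr aPerm) //.
    by have -> : lmem s3 aPerm 0 0 i = q i by rewrite -s1q.
  move: (sem n m (SFor vK EPoints c) s3) => s4 h4 f4 l' j'; rewrite /insert.
  case: ifP => [/andP[/eqP-> /eqP->]|lj].
    split; last by move=> k; exact: h4.
    rewrite f4 // /s3 /= /lupd /=.
    by rewrite !s1l s1q !eqxx.
  have E k : lmem s4 aTab l' j' k = lmem s1 aTab l' j' k.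
    rewrite f4 //=; apply/negP => /andP[/eqP/val_inj e1 /eqP/val_inj e2].
    by rewrite e1 e2 !eqxx in lj.
  have E' : lmem s4 aHas l' j' 0 = lmem s1 aHas l' j' 0.
    rewrite f4 // /s3 /= /lupd /= s1l s1q.
    by rewrite -!val_eqE /= in lj; rewrite andbT lj.
  have := st1 l' j'; case: (tb l' j') => [u [h1 h2]|h1]; rewrite E' //.
  by split=> // k; rewrite E h2.
- exact: transversals_insert.
- move=> u /entriesP[l' [j']]; rewrite /insert; case: ifP => [_ [<-] //|_ eu].
  by apply: sub; apply/entriesP; exists l', j'.
- exact: subtable_insert.
- split; last by rewrite e // drop_enum_ord /= eN.
  rewrite e; last exact: subtable_insert.
  by rewrite sift_insert // sift1 //; exact: transversals_insert.
Qed.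

Lemma reset_entry s (l j : 'I_n) :
  let s' := sem n m (SIf (EEq (var vL) (var vJ))
       (SSeq (SSet aHas (var vL) (var vJ) zero one)
          (SFor vK EPoints (SSet aTab (var vL) (var vJ) (var vK) (var vK))))
       (SSet aHas (var vL) (var vJ) zero zero)) s in
  lmem s vL 0 0 0 = l -> lmem s vJ 0 0 0 = j ->
  (if l == j then lmem s' aHas l j 0 != 0 /\ holds s' aTab l j 1
   else lmem s' aHas l j 0 = 0) /\
  forall l' j' k', ~~ ((l' == l) && (j' == j)) ->
    lmem s' aHas l' j' k' = lmem s aHas l' j' k' /\
    lmem s' aTab l' j' k' = lmem s aTab l' j' k'.
Proof.
move=> s' sl sj.
have sE : eval n m s (EEq (var vL) (var vJ)) = (l == j) by rewrite /= sl sj.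
case: (boolP (l == j)) => lj; last first.
  have -> : s' = lset s aHas l j 0 0.
    by rewrite /s' sem_ifF ?sE ?(negPf lj) //= sl sj.
  rewrite /= /lupd !eqxx /=; split=> // l' j' k' ne; split=> //.
  by rewrite andbA (negPf ne).
rewrite /s' sem_ifT ?sE ?lj // sem_seq; set s1 := sem n m _ s.
have s1l : lmem s1 vL 0 0 0 = l by [].
have s1j : lmem s1 vJ 0 0 0 = j by [].
have [] := @for_store n m vK (SSet aTab (var vL) (var vJ) (var vK) (var vK)) s1
  aTab l j id (fun k => k) (@inj_id _) isT.
  move=> i s2 fr un si b i' j' k' bk /=.
  by rewrite si (fr vL) // (fr vJ) // s1l s1j.
move: (sem n m (SFor _ _ _) s1) => s2 h2 f2; split.
  split; last by move=> k; rewrite perm1 h2.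
  by rewrite f2 // /s1 /= /lupd sl sj !eqxx.
move=> l' j' k' ne; rewrite !f2 //=; split=> //.
by rewrite /lupd sl sj /= andbA (negPf ne).
Qed.

Definition unit_table (l j : 'I_n) : option 'S_n :=
  if l == j then Some 1%g else None.

Lemma transversals_unit : transversals unit_table.
Proof.
split=> [l|l j u]; first by rewrite /unit_table eqxx.
rewrite /unit_table; case: eqP => // -> [<-].
by split=> [|x _]; rewrite perm1.
Qed.

Lemma entries_unit u : u \in entries unit_table -> u = 1%g.
Proof. by case/entriesP => l [j]; rewrite /unit_table; case: ifP => // _ [<-]. Qed.

Lemma reset_spec s : holds_table (sem n m p_reset s) unit_table.
Proof.
pose ok s (l j : 'I_n) :=
  if l == j then lmem s aHas l j 0 != 0 /\ holds s aTab l j 1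
  else lmem s aHas l j 0 = 0.
suff H : forall l j, ok (sem n m p_reset s) l j.
  by move=> l j; move: (H l j); rewrite /ok /unit_table; case: ifP.
have okE s1 s2 (l j : 'I_n) :
    (forall k, lmem s2 aHas l j k = lmem s1 aHas l j k /\
       lmem s2 aTab l j k = lmem s1 aTab l j k) -> ok s1 l j -> ok s2 l j.
  move=> e; rewrite /ok (proj1 (e 0)); case: ifP => // _ [h1 h2]; split=> // k.
  by rewrite (proj2 (e k)).
suff : forall l j : 'I_n, l < n -> ok (sem n m p_reset s) l j.
  by move=> h l j; exact: h.
apply: (for_points (P := fun t s' => forall l j : 'I_n, l < t -> ok s' l j)) => //.
move=> l s1 h1.
(* Progress is lexicographic: all earlier rows, and in row [l] the columns already visited. *)
suff : lmem (sem n m (SFor vJ EPoints (SIf (EEq (var vL) (var vJ))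
       (SSeq (SSet aHas (var vL) (var vJ) zero one)
          (SFor vK EPoints (SSet aTab (var vL) (var vJ) (var vK) (var vK))))
       (SSet aHas (var vL) (var vJ) zero zero))) (lset s1 vL 0 0 0 l)) vL 0 0 0 = l /\
   forall l' j' : 'I_n, (l' < l) || (l' == l) && (j' < n) ->
     ok (sem n m (SFor vJ EPoints (SIf (EEq (var vL) (var vJ))
       (SSeq (SSet aHas (var vL) (var vJ) zero one)
          (SFor vK EPoints (SSet aTab (var vL) (var vJ) (var vK) (var vK))))
       (SSet aHas (var vL) (var vJ) zero zero))) (lset s1 vL 0 0 0 l)) l' j'.
  move=> [_ h] l' j'; rewrite ltnS leq_eqVlt => /orP[/eqP/val_inj e|lt]; apply: h.
    by rewrite e eqxx ltn_ord orbT.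
  by rewrite lt.
apply: (for_points (P := fun t s' => lmem s' vL 0 0 0 = l /\
  forall l' j' : 'I_n, (l' < l) || (l' == l) && (j' < t) -> ok s' l' j')).
  split=> // l' j'; rewrite ltn0 andbF orbF => lt.
  by apply: okE (h1 l' j' lt) => k.
move=> j s2 [s2l h2]; set s3 := lset s2 vJ 0 0 0 j.
have [h3 h4] := reset_entry (s := s3) s2l (erefl : lmem s3 vJ 0 0 0 = j).
split; first by rewrite sem_frame.
move=> l' j'; case: (boolP ((l' == l) && (j' == j))) => [/andP[/eqP-> /eqP->] _|ne].
  exact: h3.
move=> lt; apply: (okE s3) => [k|]; first by apply: h4; move: ne; rewrite -!val_eqE.
apply: (okE s2) => // ; apply: h2.
by move: lt ne; rewrite -!val_eqE /=; lia.
Qed.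

End Table.

(** * Construction of closed tables and membership tests *)

Definition p_load (cond : expr) : stmt :=
  SFor vK EPoints (SIf cond
    (set1 aPerm (var vK) (EGet aGen (var vX) zero (var vK)))
    (set1 aPerm (var vK) (var vK))).

(* A round either finds the table closed or fills one of the n ^ 2 entries, of
   which the diagonal ones are filled from the start. *)
Definition p_build (cond : expr) : stmt :=
  SSeq p_reset
    (SSeq (SFor vX EGens (SSeq (p_load cond) (SSeq p_sift p_insert)))
       (SFor vR1 EPoints (SFor vR2 EPoints p_round))).

Definition p_test_cell : stmt :=
  SSeq (setv vAll one) (SFor vX EGens
    (SSeq (p_load (EEq (get1 aCell (var vK)) (var vC)))
       (SSeq p_sift (SIf (var vOk) SSkip (setv vAll zero))))).

Section Build.
Variables (n m : nat) (K : {group 'S_n}).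
Implicit Types (s : lstate) (p q u w : 'S_n) (tb : 'I_n -> 'I_n -> option 'S_n).

Definition closed_table tb : Prop := forall u w, u \in entries tb ->
  w \in entries tb -> sift tb (enum 'I_n) (u * w)%g.

Definition table_inv s tb : Prop :=
  [/\ holds_table s tb, transversals tb & {subset entries tb <= K}].

(** By the second clause, rounds run after the table is closed do no harm, so the number of rounds
    can be fixed in advance. *)
Definition refines tb tb' : Prop :=
  subtable tb tb' /\ (closed_table tb -> tb' = tb).

Lemma refines_refl tb : refines tb tb. Proof. by split. Qed.

Lemma refines_trans tb1 tb2 tb3 :
  refines tb1 tb2 -> refines tb2 tb3 -> refines tb1 tb3.
Proof.
move=> [s12 c12] [s23 c23]; split; first exact: subtable_trans s23.
by move=> cl; have e := c12 cl; rewrite c23 // e.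
Qed.

Lemma table_inv_lset s tb v i j k x : v \notin [:: aTab; aHas] ->
  table_inv s tb -> table_inv (lset s v i j k x) tb.
Proof. by move=> h [h1 h2 h3]; split=> //; exact: holds_table_lset. Qed.

Lemma pair_spec s tb (l1 j1 l2 j2 : 'I_n) :
  lmem s vL1 0 0 0 = l1 -> lmem s vJ1 0 0 0 = j1 ->
  lmem s vL2 0 0 0 = l2 -> lmem s vJ2 0 0 0 = j2 -> table_inv s tb ->
  exists tb', [/\ table_inv (sem n m p_pair s) tb', refines tb tb' &
    forall u w, tb l1 j1 = Some u -> tb l2 j2 = Some w ->
      sift tb' (enum 'I_n) (u * w)%g].
Proof.
move=> sl1 sj1 sl2 sj2 sI; have [st tr sub] := sI; rewrite /p_pair.
have s1E : eval n m s (EGet aHas (var vL1) (var vJ1) zero) = lmem s aHas l1 j1 0.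
  by rewrite -sl1 -sj1.
have s2E : eval n m s (EGet aHas (var vL2) (var vJ2) zero) = lmem s aHas l2 j2 0.
  by rewrite -sl2 -sj2.
have := st l1 j1; case e1: (tb l1 j1) => [u|] => [[h1 su]|h1]; last first.
  by rewrite sem_ifF ?s1E //; exists tb; split=> //; exact: refines_refl.
rewrite sem_ifT ?s1E //.
have := st l2 j2; case e2: (tb l2 j2) => [w|] => [[h2 sw]|h2]; last first.
  by rewrite sem_ifF ?s2E //; exists tb; split=> //; exact: refines_refl.
rewrite sem_ifT ?s2E // sem_seq.
have uE : u \in entries tb by apply/entriesP; exists l1, j1.
have wE : w \in entries tb by apply/entriesP; exists l2, j2.
have [] := @for_store n m vK (set1 aPerm (var vK)
  (EGet aTab (var vL2) (var vJ2) (EGet aTab (var vL1) (var vJ1) (var vK)))) s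
  aPerm 0 0 id (fun k => (u * w)%g k) (@inj_id _) isT.
  move=> i s' fr un si b i' j' k' bk /=.
  rewrite si (fr vL1) // (fr vJ1) // (fr vL2) // (fr vJ2) // sl1 sj1 sl2 sj2.
  by rewrite (fr aTab l1) // su (fr aTab) // sw permM.
move=> h _.
have st1 : holds_table (sem n m p_product s) tb by exact: holds_table_sem.
have uwK : (u * w)%g \in K by rewrite groupM ?sub.
have [tb' [h3 h4 h5 h6 [h7 h8]]] := insert_spec m tr sub uwK st1 h.
exists tb'; split=> //; first by split=> // cl; apply: h8; exact: cl.
by move=> _ _ [<-] [<-].
Qed.

(** Only products of entries present at the start of the round are guaranteed to sift. Entries
    inserted meanwhile may form new products, which is why rounds are repeated. *)
Lemma round_spec s tb : table_inv s tb ->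
  exists tb', [/\ table_inv (sem n m p_round s) tb', refines tb tb' &
    forall u w, u \in entries tb -> w \in entries tb ->
      sift tb' (enum 'I_n) (u * w)%g].
Proof.
move=> sI.
pose Q l1 j1 l2 j2 tb' := forall u w, tb l1 j1 = Some u -> tb l2 j2 = Some w ->
  sift tb' (enum 'I_n) (u * w)%g.
have Qmono l1 j1 l2 j2 x y : refines x y -> Q l1 j1 l2 j2 x -> Q l1 j1 l2 j2 y.
  by move=> [xy _] q u w eu ew; apply: (sift_mono xy); exact: q.
pose I s' tb' := table_inv s' tb' /\ subtable tb tb'.
have IS v x s' tb' : v \notin [:: aTab; aHas] -> I s' tb' -> I (lset s' v 0 0 0 x) tb'.
  by move=> nv [h1 h2]; split=> //; exact: table_inv_lset.
have pairP (l1 j1 l2 j2 : 'I_n) s' tb' :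
    [/\ lmem s' vL1 0 0 0 = l1, lmem s' vJ1 0 0 0 = j1,
        lmem s' vL2 0 0 0 = l2, lmem s' vJ2 0 0 0 = j2 & I s' tb'] ->
    exists tb'', [/\ I (sem n m p_pair s') tb'', refines tb' tb'' & Q l1 j1 l2 j2 tb''].
  move=> [h1 h2 h3 h4 [inv sb]].
  have [tb'' [inv' [sb' cl] q]] := pair_spec h1 h2 h3 h4 inv.
  exists tb''; split=> //; first by split=> //; exact: subtable_trans sb'.
  by move=> u w eu ew; apply: q; exact: sb.
have J2P (l1 j1 l2 : 'I_n) s' tb' :
    [/\ lmem s' vL1 0 0 0 = l1, lmem s' vJ1 0 0 0 = j1,
        lmem s' vL2 0 0 0 = l2 & I s' tb'] ->
    exists tb'', [/\ I (sem n m (SFor vJ2 EPoints p_pair) s') tb'', refines tb' tb'' &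
      forall j2, Q l1 j1 l2 j2 tb''].
  move=> [h1 h2 h3 inv].
  have [] := @for_ghost n m _ (fun s' tb' => [/\ lmem s' vL1 0 0 0 = l1,
    lmem s' vJ1 0 0 0 = j1, lmem s' vL2 0 0 0 = l2 & I s' tb']) refines
    (fun j2 => Q l1 j1 l2 j2) vJ2 p_pair s' tb' refines_refl refines_trans.
  - by move=> j2 x y; exact: Qmono.
  - by split.
  - move=> j2 s1 tb1 [k1 k2 k3 inv1] _.
    have [|tb2 [inv2 r2 q2]] := @pairP l1 j1 l2 j2 (lset s1 vJ2 0 0 0 j2) tb1.
      by split=> //; exact: IS.
    by exists tb2; split=> //; split=> //; rewrite sem_frame.
  - by move=> tb2 [[_ _ _ inv2] r2 q2]; exists tb2.
have L2P (l1 j1 : 'I_n) s' tb' :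
    [/\ lmem s' vL1 0 0 0 = l1, lmem s' vJ1 0 0 0 = j1 & I s' tb'] ->
    exists tb'', [/\ I (sem n m (SFor vL2 EPoints (SFor vJ2 EPoints p_pair)) s') tb'',
      refines tb' tb'' & forall l2 j2, Q l1 j1 l2 j2 tb''].
  move=> [h1 h2 inv].
  have [] := @for_ghost n m _ (fun s' tb' => [/\ lmem s' vL1 0 0 0 = l1,
    lmem s' vJ1 0 0 0 = j1 & I s' tb']) refines
    (fun l2 x => forall j2, Q l1 j1 l2 j2 x) vL2 (SFor vJ2 EPoints p_pair) s' tb'
    refines_refl refines_trans.
  - by move=> l2 x y xy q j2; exact: Qmono xy (q j2).
  - by split.
  - move=> l2 s1 tb1 [k1 k2 inv1] _.
    have [|tb2 [inv2 r2 q2]] := @J2P l1 j1 l2 (lset s1 vL2 0 0 0 l2) tb1.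
      by split=> //; exact: IS.
    by exists tb2; split=> //; split=> //; rewrite sem_frame.
  - by move=> tb2 [[_ _ inv2] r2 q2]; exists tb2.
have J1P (l1 : 'I_n) s' tb' : lmem s' vL1 0 0 0 = l1 -> I s' tb' ->
    exists tb'', [/\ I (sem n m (SFor vJ1 EPoints (SFor vL2 EPoints
      (SFor vJ2 EPoints p_pair))) s') tb'', refines tb' tb'' &
      forall j1 l2 j2, Q l1 j1 l2 j2 tb''].
  move=> h1 inv.
  have [] := @for_ghost n m _ (fun s' tb' => lmem s' vL1 0 0 0 = l1 /\ I s' tb') refines
    (fun j1 x => forall l2 j2, Q l1 j1 l2 j2 x) vJ1
    (SFor vL2 EPoints (SFor vJ2 EPoints p_pair)) s' tb' refines_refl refines_trans.
  - by move=> j1 x y xy q l2 j2; exact: Qmono xy (q l2 j2).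
  - by split.
  - move=> j1 s1 tb1 [k1 inv1] _.
    have [|tb2 [inv2 r2 q2]] := @L2P l1 j1 (lset s1 vJ1 0 0 0 j1) tb1.
      by split=> //; exact: IS.
    by exists tb2; split=> //; split=> //; rewrite sem_frame.
  - by move=> tb2 [[_ inv2] r2 q2]; exists tb2.
have [] := @for_ghost n m _ I refines
    (fun l1 x => forall j1 l2 j2, Q l1 j1 l2 j2 x) vL1
    (SFor vJ1 EPoints (SFor vL2 EPoints (SFor vJ2 EPoints p_pair))) s tb
    refines_refl refines_trans.
- by move=> l1 x y xy q j1 l2 j2; exact: Qmono xy (q j1 l2 j2).
- by split.
- move=> l1 s1 tb1 inv1 _.
  have [|tb2 [inv2 r2 q2]] := @J1P l1 (lset s1 vL1 0 0 0 l1) tb1 erefl; first exact: IS.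
  by exists tb2; split.
move=> tb2 [[inv2 _] r2 q2]; exists tb2; split=> //.
by move=> u w /entriesP[l1 [j1 eu]] /entriesP[l2 [j2 ew]]; exact: q2 eu ew.
Qed.

Definition filled tb : {set 'I_n * 'I_n} := [set lj | tb lj.1 lj.2].

Lemma filled_subtable tb tb' : subtable tb tb' -> filled tb \subset filled tb'.
Proof.
move=> sb; apply/subsetP => -[l j]; rewrite !inE /=.
by case e: (tb l j) => [u|//] _; rewrite (sb _ _ _ e).
Qed.

Lemma filled_eq tb tb' : subtable tb tb' -> #|filled tb'| <= #|filled tb| ->
  subtable tb' tb.
Proof.
move=> sb le l j u e.
have /setP/(_ (l, j)) : filled tb = filled tb'.
  by apply/eqP; rewrite eqEcard filled_subtable.
rewrite !inE /= e; case e': (tb l j) => [v|//] _.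
by move: (sb _ _ _ e'); rewrite e => -[->].
Qed.

Lemma rounds_spec s tb : 0 < n -> table_inv s tb ->
  exists tb',
    [/\ table_inv (sem n m (SFor vR1 EPoints (SFor vR2 EPoints p_round)) s) tb',
        subtable tb tb' & closed_table tb'].
Proof.
move=> n0 sI.
pose P t s' := exists tb', [/\ table_inv s' tb', subtable tb tb' &
  closed_table tb' \/ t < #|filled tb'|].
have PS t s' v x : v \notin [:: aTab; aHas] -> P t s' -> P t (lset s' v 0 0 0 x).
  by move=> nv [tb' [h1 h2 h3]]; exists tb'; split=> //; exact: table_inv_lset.
have roundP t s' : P t s' -> P t.+1 (sem n m p_round s').
  move=> [tb1 [inv1 sb1 c1]]; have [tb2 [inv2 [sb2 cl2] q2]] := round_spec inv1.
  exists tb2; split=> //; first exact: subtable_trans sb2.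
  (* If nothing was filled, the products that sift in [tb2] already sift in [tb1], so [tb1] was
     closed. *)
  case: (leqP #|filled tb2| #|filled tb1|) => le.
    have sb21 := filled_eq sb2 le.
    have cl1 : closed_table tb1.
      by move=> u w uE wE; apply: (sift_mono sb21); exact: q2.
    by left; rewrite cl2.
  case: c1 => [c1|lt]; first by left; rewrite cl2.
  by right; exact: leq_trans le.
have [] : P (n * n) (sem n m (SFor vR1 EPoints (SFor vR2 EPoints p_round)) s).
  apply: (for_points (P := fun t => P (t * n))).
    (* One diagonal entry is filled before any round, so [n * n] strict increases would exceed the
       size of the table. *)
    exists tb; split=> //; right; apply/card_gt0P.
    exists (Ordinal n0, Ordinal n0); rewrite inE /=.
    by case: sI => _ [-> _] _.
  move=> r1 s1 h1; rewrite mulSn addnC.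
  apply: (for_points (P := fun t => P (r1 * n + t))).
    by rewrite addn0; exact: PS.
  by move=> r2 s2 h2; rewrite addnS; apply: roundP; exact: PS.
move=> tb' [inv' sb' [cl|lt]]; exists tb'; split=> //.
have := max_card (mem (filled tb')); rewrite card_prod !card_ord.
by rewrite leqNgt lt.
Qed.

End Build.

Section BuildSpec.
Variables (n : nat) (gens : seq 'S_n).
Local Notation m := (size gens).
Implicit Types (s : lstate) (p q u w : 'S_n) (tb : 'I_n -> 'I_n -> option 'S_n).

Definition holds_gens s : Prop :=
  forall x, x < m -> holds s aGen x 0 (nth 1%g gens x).

(* [cond] may not depend on what the programs below overwrite. *)
Definition decides s cond (D : {set 'I_n}) : Prop := forall s' (k : 'I_n),
  lmem s' vK 0 0 0 = k ->
  (forall a i j, a \in [:: aCell; vC] -> forall k, lmem s' a i j k = lmem s a i j k) ->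
  (eval n m s' cond != 0) = (k \in D).

Lemma load_spec s cond D (H : {group 'S_n}) x : decides s cond D ->
  stable H D -> x < m -> nth 1%g gens x \in H -> lmem s vX 0 0 0 = x ->
  holds s aGen x 0 (nth 1%g gens x) ->
  holds (sem n m (p_load cond) s) aPerm 0 0 (restr_perm D (nth 1%g gens x)).
Proof.
move=> dc stD xm gH sx sg.
have [] := @for_store n m vK (SIf cond
    (set1 aPerm (var vK) (EGet aGen (var vX) zero (var vK)))
    (set1 aPerm (var vK) (var vK))) s aPerm 0 0 id
  (fun k => restr_perm D (nth 1%g gens x) k) (@inj_id _) isT.
  move=> i s' fr un si b i' j' k' bk.
  have c : (eval n m s' cond != 0) = (i \in D).
    apply: dc => // a i1 j1; rewrite !inE => /orP[]/eqP-> k1; exact: fr.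
  rewrite (restr_stableE _ stD gH) -c; case: ifP => h.
    by rewrite sem_ifT //= si (fr vX) // sx (fr aGen) // sg.
  by rewrite sem_ifF //= ?si //; apply/eqP; rewrite -[_ == _]negbK h.
by move=> h _ k; exact: h.
Qed.

Lemma decides_eq s s' cond D :
  (forall a i j k, a \in [:: aCell; vC] -> lmem s' a i j k = lmem s a i j k) ->
  decides s cond D -> decides s' cond D.
Proof.
move=> e h s1 k sk e1; apply: h => // a i j ain k'.
by rewrite e1 // e.
Qed.

Lemma build_spec (H : {group 'S_n}) s cond D : 0 < n -> H :=: <<[set g in gens]>>%g ->
  stable H D -> holds_gens s -> decides s cond D ->
  exists tb, [/\ holds_table (sem n m (p_build cond) s) tb, transversals tb &
    forall p, sift tb (enum 'I_n) p = (p \in (restr_perm D @* H)%g)].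
Proof.
move=> n0 HE stD sg dc; rewrite /p_build !sem_seq.
set s1 := sem n m p_reset s.
have gH g : g \in gens -> g \in H by move=> gin; rewrite HE mem_gen // inE.
have nthH x : x < m -> nth 1%g gens x \in H by move=> xm; exact/gH/mem_nth.
set K := (restr_perm D @* H)%G.
have restrK g : g \in H -> restr_perm D g \in K.
  by move=> gin; apply: mem_morphim => //; exact: subsetP (stable_astabs stD) _ gin.
pose P x s' := (forall a i j k, a \in [:: aGen; aCell; vC] ->
    lmem s' a i j k = lmem s a i j k) /\
  exists tb, table_inv K s' tb /\ forall y, y < x ->
    sift tb (enum 'I_n) (restr_perm D (nth 1%g gens y)).
have [_ [tb [inv gpass]]] : P m (sem n m (SFor vX EGens
    (SSeq (p_load cond) (SSeq p_sift p_insert))) s1).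
  apply: (for_ind (e := EGens)).
    split; first by move=> a i j k; rewrite !inE => /or3P[]/eqP->; exact: sem_frame.
    exists (@unit_table n); split=> //; split; first exact: reset_spec.
      exact: transversals_unit.
    by move=> u /entries_unit ->; exact: group1.
  move=> x s2 xm [fr [tb [[st tr sub] pass]]]; set s3 := lset s2 vX 0 0 0 x.
  split.
    move=> a i j k ain; rewrite sem_frame; last first.
      by move: ain; rewrite !inE => /or3P[]/eqP->.
    by rewrite -fr //; move: ain; rewrite !inE => /or3P[]/eqP->.
  have sp : holds (sem n m (p_load cond) s3) aPerm 0 0 (restr_perm D (nth 1%g gens x)).
    apply: (load_spec _ stD xm (nthH _ xm)) => //.
      by apply: decides_eq dc => a i j k; rewrite !inE => /orP[]/eqP->; exact: fr.
    by move=> k; rewrite -(sg _ xm) -fr.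
  have st3 : holds_table (sem n m (p_load cond) s3) tb.
    by apply: holds_table_sem => //; exact: holds_table_lset.
  have [tb' [h3 h4 h5 h6 [h7 _]]] := insert_spec m tr sub (restrK _ (nthH _ xm)) st3 sp.
  exists tb'; split=> // y; rewrite ltnS leq_eqVlt => /orP[/eqP->//|yx].
  by apply: sift_mono h6 _; exact: pass.
have [tb' [[h1 h2 h3] sb cl]] := rounds_spec m n0 inv.
exists tb'; split=> // p.
(* Restriction to a stable set is a morphism on [H], so the restricted generators generate the
   image. *)
have KE : K :=: <<[set restr_perm D g | g in gens]>>%g.
  rewrite /= HE morphim_gen; last first.
    by apply: subset_trans (stable_astabs stD); rewrite HE subset_gen.
  congr <<_>>%g; apply/setP => q; apply/morphimP/imsetP => [[g _ gin ->]|[g gin ->]].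
    by exists g => //; rewrite inE in gin.
  exists g => //; last by rewrite inE.
  exact: subsetP (stable_astabs stD) _ (gH _ gin).
rewrite -[(_ @* _)%g]/(gval K) KE; apply: sift_gen => //; first by rewrite -KE.
move=> _ /imsetP[g gin ->]; apply: sift_mono sb _.
by rewrite -(nth_index 1%g gin); apply: gpass; rewrite index_mem.
Qed.

Lemma sift_test s tb p : transversals tb -> holds_table s tb ->
  holds s aPerm 0 0 p -> lmem (sem n m p_sift s) vOk 0 0 0 = sift tb (enum 'I_n) p.
Proof.
move=> tr st sp.
(* Only the verdict matters here, so the whole symmetric group serves as ambient group. *)
have [] := @sift_spec n m [set: 'S_n]%G s _ tb p tr _ _ st sp erefl.
- by move=> u _; rewrite inE.
- by rewrite inE.
- by move=> [-> ->].
- move=> [-> [q [l [_ _ _ eN e]]]].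
  by rewrite e // drop_enum_ord /= eN.
Qed.

Lemma test_cell_spec (H : {group 'S_n}) s tb (F : {set 'I_n}) (cl : 'I_n -> nat) c :
  H :=: <<[set g in gens]>>%g -> stable H F -> holds_gens s ->
  transversals tb -> holds_table s tb -> lmem s vC 0 0 0 = c ->
  (forall k : 'I_n, lmem s aCell 0 0 k = cl k) -> F = [set x | cl x == c] ->
  lmem (sem n m p_test_cell s) vAll 0 0 0 =
    all (fun g => sift tb (enum 'I_n) (restr_perm F g)) gens.
Proof.
move=> HE stF sg tr st sc scl FE; rewrite /p_test_cell sem_seq.
set s1 := sem n m (setv _ _) s.
have gH g : g \in gens -> g \in H by move=> gin; rewrite HE mem_gen // inE.
have nthH x : x < m -> nth 1%g gens x \in H by move=> xm; exact/gH/mem_nth.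
pose P x s' := [/\ (forall a i j k, a \in [:: aGen; aCell; vC; aTab; aHas] ->
    lmem s' a i j k = lmem s a i j k) & lmem s' vAll 0 0 0 =
    all (fun g => sift tb (enum 'I_n) (restr_perm F g)) (take x gens)].
have [] : P m (sem n m (SFor vX EGens
    (SSeq (p_load (EEq (get1 aCell (var vK)) (var vC)))
       (SSeq p_sift (SIf (var vOk) SSkip (setv vAll zero))))) s1); last first.
  by rewrite take_size.
apply: (for_ind (e := EGens)).
  split; last by rewrite take0.
  by move=> a i j k; rewrite !inE => /or4P[|||/orP[]]/eqP->.
move=> x s2 xm [fr al]; set s3 := lset s2 vX 0 0 0 x.
have fr3 a i j k : a \in [:: aGen; aCell; vC; aTab; aHas] ->
    lmem s3 a i j k = lmem s a i j k.
  by move=> ain; rewrite -fr //; move: ain; rewrite !inE => /or4P[|||/orP[]]/eqP->.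
split.
  move=> a i j k ain; rewrite sem_frame ?fr3 //.
  by move: ain; rewrite !inE => /or4P[|||/orP[]]/eqP->.
rewrite !sem_seq; set s4 := sem n m (p_load _) s3.
have s4p : holds s4 aPerm 0 0 (restr_perm F (nth 1%g gens x)).
  apply: (load_spec _ stF xm (nthH _ xm)) => //.
    move=> s' k sk e /=; rewrite sk e // fr3 // e // fr3 // sc scl FE inE.
    by case: (cl k == c).
  by move=> k; rewrite fr3 // sg.
have st4 : holds_table s4 tb.
  by apply: holds_table_eq st => i j k; rewrite sem_frame // fr3.
have al4 : lmem (sem n m p_sift s4) vAll 0 0 0 = lmem s2 vAll 0 0 0.
  by rewrite !sem_frame.
have ok := sift_test tr st4 s4p.
rewrite (take_nth 1%g) // all_rcons; case: (sift _ _ _) ok => ok.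
  by rewrite sem_ifT /= ?ok // al4.
by rewrite sem_ifF.
Qed.

End BuildSpec.

(** * Input, support and orbits *)

Definition p_read : stmt :=
  SFor vX EGens (SFor vK EPoints (SRead aGen (var vX) zero (var vK))).

Definition p_moved : stmt :=
  SFor vX EGens (SFor vK EPoints
    (SIf (EEq (EGet aGen (var vX) zero (var vK)) (var vK)) SSkip
       (set1 aMoved (var vK) one))).

(* The class of the image of a point is relabelled by the label of the point, so
   that one pass over the generators and points computes the orbits. *)
Definition p_join : stmt :=
  SSeq (setv vA (get1 aOrb (var vK)))
    (SSeq (setv vB (get1 aOrb (EGet aGen (var vX) zero (var vK))))
       (SFor vY EPoints (SIf (EEq (get1 aOrb (var vY)) (var vB))
          (set1 aOrb (var vY) (var vA)) SSkip))).

Definition p_orbits : stmt :=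
  SSeq (SFor vK EPoints (set1 aOrb (var vK) (var vK)))
    (SFor vX EGens (SFor vK EPoints p_join)).

Section Orbits.
Variables (n : nat) (gens : seq 'S_n) (H : {group 'S_n}).
Hypothesis HE : H :=: <<[set g in gens]>>%g.
Local Notation m := (size gens).
Implicit Types (s : lstate) (orb : 'I_n -> 'I_n) (g h : 'S_n).

Lemma drop_encode g (k : 'I_n) :
  drop k (encode_perm g) = val (g k) :: drop k.+1 (encode_perm g).
Proof. by rewrite /encode_perm -map_drop drop_enum_ord /= map_drop. Qed.

Lemma read_spec s : linp s = flatten [seq encode_perm g | g <- gens] ->
  holds_gens gens (sem n m p_read s).
Proof.
move=> si.
pose P x s' := linp s' = flatten [seq encode_perm g | g <- drop x gens] /\
  forall y, y < x -> holds s' aGen y 0 (nth 1%g gens y).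
have [] : P m (sem n m p_read s); last by move=> _ h x xm; exact: h.
apply: (for_ind (e := EGens)); first by split; rewrite // drop0.
move=> x s1 xm [i1 h1].
pose P' k s' := [/\ lmem s' vX 0 0 0 = x,
  linp s' = drop k (encode_perm (nth 1%g gens x)) ++
            flatten [seq encode_perm g | g <- drop x.+1 gens],
  forall y, y < x -> holds s' aGen y 0 (nth 1%g gens y) &
  forall k' : 'I_n, k' < k -> lmem s' aGen x 0 k' = nth 1%g gens x k'].
have [] : P' n (sem n m (SFor vK EPoints (SRead aGen (var vX) zero (var vK)))
    (lset s1 vX 0 0 0 x)).
  apply: for_points.
    split=> //; first by rewrite /= i1 drop0 (drop_nth 1%g).
  move=> k s2 [h2 i2 h3 h4].
  have v : val (nth 1%g gens x k) < radix n m.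
    by apply: leq_trans (ltn_ord _) _; rewrite /radix; lia.
  split=> //=.
  - by rewrite i2 drop_encode.
  - move=> y yx k'; rewrite /lupd /= h2 (ltn_eqF yx) /=; exact: h3.
  - move=> k'; rewrite /lupd /= h2 eqxx /= i2 drop_encode /= v ltnS leq_eqVlt.
    by case: eqP => [/val_inj->|_] //=; exact: h4.
move=> h2 i2 h3 h4; split.
  by rewrite i2 drop_oversize // size_map size_enum_ord.
move=> y; rewrite ltnS leq_eqVlt => /orP[/eqP->|]; last exact: h3.
by move=> k; exact: h4.
Qed.

Lemma gen_in_H x : x < m -> nth 1%g gens x \in H.
Proof. by move=> xm; rewrite HE mem_gen // inE mem_nth. Qed.

Lemma psupp_gens x : (x \in psupp H) = has (fun g => g x != x) gens.
Proof.
apply/idP/hasP => [|[g gin gx]]; last first.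
  by rewrite inE; apply/existsP; exists g; rewrite gx HE mem_gen ?inE.
move=> xH; apply/hasP; move: xH; apply: contraTT => /hasPn h.
have HC : H \subset 'C([set x] | 'P)%g.
  rewrite HE gen_subG; apply/subsetP => g; rewrite inE => /h /negPn /eqP e.
  by apply/astabP => y; rewrite inE => /eqP->.
rewrite inE; apply/existsPn => g; rewrite negb_and negbK -implybE.
apply/implyP => gH; apply/eqP.
by apply: (astabP (subsetP HC _ gH)); rewrite inE.
Qed.

Lemma moved_spec s : holds_gens gens s ->
  (forall k : 'I_n, lmem s aMoved 0 0 k = 0) ->
  forall k : 'I_n, (lmem (sem n m p_moved s) aMoved 0 0 k != 0) = (k \in psupp H).
Proof.
move=> sg s0 k; rewrite psupp_gens.
pose P x s' := (forall i j k, lmem s' aGen i j k = lmem s aGen i j k) /\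
  forall k : 'I_n, (lmem s' aMoved 0 0 k != 0) =
    has (fun g => g k != k) (take x gens).
have [] : P m (sem n m p_moved s); last by rewrite take_size.
apply: (for_ind (e := EGens)); first by split=> // k'; rewrite take0 s0.
move=> x s1 xm [fr h1]; set s2 := lset s1 vX 0 0 0 x.
split; first by move=> i j k'; rewrite sem_frame //= /lupd fr.
have [] := @for_store n m vK (SIf (EEq (EGet aGen (var vX) zero (var vK)) (var vK))
   SSkip (set1 aMoved (var vK) one)) s2 aMoved 0 0 id
   (fun k => if nth 1%g gens x k == k then lmem s1 aMoved 0 0 k else 1) (@inj_id _) isT.
  move=> i s' fr' un si b i' j' k' bk.
  have E : eval n m s' (EEq (EGet aGen (var vX) zero (var vK)) (var vK)) =
      (nth 1%g gens x i == i).
    by rewrite /= si (fr' vX) // (fr' aGen) //= /lupd /= fr sg // val_eqE.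
  case: ifP E => e E; last by rewrite sem_ifF //= si.
  rewrite sem_ifT ?E //= /lupd; case: ifP => // /and4P[/eqP-> /eqP-> /eqP-> /eqP->].
  by rewrite un.
move=> h _ k'; rewrite h (take_nth 1%g) // has_rcons -h1.
by case: (nth 1%g gens x k' == k').
Qed.

Definition orbit_labels orb : Prop :=
  (forall x, orb x \in orbit 'P H x) /\
  (forall h x, h \in H -> orb (h x) = orb x).

Definition holds_points s a orb : Prop := forall k : 'I_n, lmem s a 0 0 k = orb k.

(** Joins only merge classes, so an equality obtained for one generator and point survives all later
    joins. *)
Definition coarser orb orb' : Prop := forall y z, orb y = orb z -> orb' y = orb' z.

Lemma join_spec s orb x (k : 'I_n) : x < m -> holds_gens gens s ->
  lmem s vX 0 0 0 = x -> lmem s vK 0 0 0 = k ->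
  holds_points s aOrb orb -> (forall y, orb y \in orbit 'P H y) ->
  exists orb', [/\ holds_points (sem n m p_join s) aOrb orb',
    forall y, orb' y \in orbit 'P H y, coarser orb orb' &
    orb' (nth 1%g gens x k) = orb' k].
Proof.
move=> xm sg sx sk so orbH; set g := nth 1%g gens x.
exists (fun y => if orb y == orb (g k) then orb k else orb y).
have gk : g k \in orbit 'P H k by apply: (mem_orbit 'P k); exact: gen_in_H.
split.
- rewrite /p_join !sem_seq; set s1 := sem n m (setv vB _) _.
  have s1A : lmem s1 vA 0 0 0 = orb k by rewrite -so -sk.
  have s1B : lmem s1 vB 0 0 0 = orb (g k).
    by rewrite /s1 /= /lupd /= sx sk sg // so.
  have [] := @for_store n m vY (SIf (EEq (get1 aOrb (var vY)) (var vB))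
    (set1 aOrb (var vY) (var vA)) SSkip) s1 aOrb 0 0 id
    (fun y => if orb y == orb (g k) then orb k else orb y) (@inj_id _) isT.
    move=> i s' fr un si b i' j' k' bk.
    have s'i : lmem s' aOrb 0 0 i = orb i by rewrite un // -so.
    have E : eval n m s' (EEq (get1 aOrb (var vY)) (var vB)) = (orb i == orb (g k)).
      by rewrite /= si (fr vB) // s1B s'i val_eqE.
    case: ifP E => e E; first by rewrite sem_ifT ?E //= si (fr vA) // s1A.
    rewrite sem_ifF //= /lupd; case: ifP => // /and4P[/eqP-> /eqP-> /eqP-> /eqP->].
    by rewrite s'i.
  by move=> h _ y; exact: h.
- move=> y; case: eqP => // e.
  rewrite -(orbit_eqP (orbH y)) e (orbit_eqP (orbH _)) (orbit_eqP gk).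
  exact: orbH.
- by move=> y z ->.
- by rewrite eqxx; case: ifP.
Qed.

Lemma orbits_spec s : holds_gens gens s ->
  exists orb, holds_points (sem n m p_orbits s) aOrb orb /\ orbit_labels orb.
Proof.
move=> sg; rewrite /p_orbits sem_seq.
have [] := @for_store n m vK (set1 aOrb (var vK) (var vK)) s aOrb 0 0 id
  (fun k => k) (@inj_id _) isT.
  by move=> i s' fr un si b i' j' k' bk /=; rewrite si.
set s1 := sem n m _ s => h1 f1.
have sg1 : holds_gens gens s1 by move=> x xm k; rewrite f1 // sg.
pose P x s' := holds_gens gens s' /\ exists orb,
  [/\ holds_points s' aOrb orb, forall y, orb y \in orbit 'P H y &
      forall y k, y < x -> orb (nth 1%g gens y k) = orb k].
have [] : P m (sem n m (SFor vX EGens (SFor vK EPoints p_join)) s1).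
  apply: (for_ind (e := EGens)).
    split=> //; exists id; split=> //; move=> y; exact: orbit_refl.
  move=> x s2 xm [sg2 [orb [ho orbH inv]]].
  have sg' v y s' : v != aGen -> holds_gens gens s' ->
      holds_gens gens (lset s' v 0 0 0 y).
    move=> nv h z zm k; rewrite /= /lupd eq_sym (negPf nv); exact: h.
  have [] := @for_ghost n m _ (fun s' orb' => [/\ lmem s' vX 0 0 0 = x,
      holds_gens gens s', holds_points s' aOrb orb' &
      forall y, orb' y \in orbit 'P H y])
    coarser (fun k orb' => orb' (nth 1%g gens x k) = orb' k) vK p_join
    (lset s2 vX 0 0 0 x) orb.
  - by move=> o y z.
  - by move=> o1 o2 o3 h12 h23 y z /h12/h23.
  - by move=> i o1 o2 h12 /h12.
  - by split=> //; exact: sg'.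
  - move=> k s3 o3 [x3 sg3 ho3 oH3] _.
    have [|||o4 [ho4 oH4 c4 e4]] :=
      @join_spec (lset s3 vK 0 0 0 k) o3 x k xm _ _ _ ho3 oH3.
    + exact: sg'.
    + by [].
    + by [].
    exists o4; split=> //; split=> //; first by rewrite sem_frame.
    by move=> y ym k'; rewrite sem_frame //; exact: sg'.
  move=> orb' [[_ sg3 ho3 oH3] c3 e3]; split=> //; exists orb'; split=> //.
  move=> y k; rewrite ltnS leq_eqVlt => /orP[/eqP->//|yx].
  by apply: c3; exact: inv.
move=> _ [orb [ho oH inv]]; exists orb; split=> //; split=> //.
(* The permutations that preserve the labels form a group, so it suffices that the generators do. *)
pose Q := [set h : 'S_n | [forall y, orb (h y) == orb y]].
have QP h : reflect (forall y, orb (h y) = orb y) (h \in Q).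
  by rewrite inE; apply: (iffP forallP) => h' y; apply/eqP.
have gQ : group_set Q.
  apply/group_setP; split; first by apply/QP => y; rewrite perm1.
  by move=> h h' /QP e /QP e'; apply/QP => y; rewrite permM e' e.
have /subsetP HQ : H \subset Q.
  rewrite HE -[Q]/(gval (Group gQ)) gen_subG; apply/subsetP => g; rewrite inE => gin.
  by apply/QP => y; rewrite -(nth_index 1%g gin) inv // index_mem.
by move=> h y /HQ /QP.
Qed.

End Orbits.

(** * The main loop over the orbits *)

Definition p_relabel : stmt :=
  SIf (var vAll) SSkip (SFor vY EPoints
    (SIf (EEq (get1 aCell (var vY)) (var vC))
       (set1 aCell (var vY) (var vI)) SSkip)).

(** The new orbit is labelled before the table is built, so that having a label other than [n]
    decides membership in the extended domain. *)
Definition p_add_orbit : stmt :=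
  SSeq (SFor vY EPoints (SIf (EEq (get1 aOrb (var vY)) (var vI))
          (set1 aCell (var vY) (var vI)) SSkip))
    (SSeq (p_build (EEq (EEq (get1 aCell (var vK)) EPoints) zero))
       (SFor vC EPoints (SSeq p_test_cell p_relabel))).

Definition p_step : stmt :=
  SIf (get1 aMoved (var vI))
    (SIf (EEq (get1 aOrb (var vI)) (var vI)) p_add_orbit SSkip) SSkip.

Definition p_main : stmt :=
  SSeq (SFor vK EPoints (set1 aCell (var vK) EPoints)) (SFor vI EPoints p_step).

Section Main.
Variables (n : nat) (gens : seq 'S_n) (H : {group 'S_n}) (orb : 'I_n -> 'I_n).
Hypothesis n0 : 0 < n.
Hypothesis HE : H :=: <<[set g in gens]>>%g.
Hypothesis orb_in : forall x, orb x \in orbit 'P H x.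
Hypothesis orb_inv : forall h x, h \in H -> orb (h x) = orb x.
Local Notation m := (size gens).
Implicit Types (s : lstate) (cl : 'I_n -> nat).

Definition holds_cells s cl : Prop := forall k : 'I_n, lmem s aCell 0 0 k = cl k.

Definition main_data s : Prop :=
  [/\ holds_gens gens s, holds_points s aOrb orb &
      forall k : 'I_n, (lmem s aMoved 0 0 k != 0) = (k \in psupp H)].

Lemma main_data_eq s s' :
  (forall a i j k, a \in [:: aGen; aOrb; aMoved] -> lmem s' a i j k = lmem s a i j k) ->
  main_data s -> main_data s'.
Proof.
move=> e [h1 h2 h3]; split=> [x xm k|k|k]; rewrite e //. exact: h1.
Qed.

Lemma relabel_spec s cl (c i : 'I_n) (b : bool) : holds_cells s cl ->
  lmem s vC 0 0 0 = c -> lmem s vI 0 0 0 = i -> lmem s vAll 0 0 0 = b ->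
  holds_cells (sem n m p_relabel s)
    (fun y => if ~~ b && (cl y == c) then i : nat else cl y).
Proof.
move=> hc sc si sb; rewrite /p_relabel; case: b sb => sb.
  by rewrite sem_ifT /= ?sb.
rewrite sem_ifF //.
have [] := @for_store n m vY (SIf (EEq (get1 aCell (var vY)) (var vC))
       (set1 aCell (var vY) (var vI)) SSkip) s aCell 0 0 id
  (fun y => if cl y == c then i : nat else cl y) (@inj_id _) isT.
  move=> y s' fr un sy b i' j' k' bk.
  have s'y : lmem s' aCell 0 0 y = cl y by rewrite un // hc.
  have E : eval n m s' (EEq (get1 aCell (var vY)) (var vC)) = (cl y == c).
    by rewrite /= sy (fr vC) // sc s'y.
  case: ifP E => e E; first by rewrite sem_ifT ?E //= sy (fr vI) // si.
  rewrite sem_ifF //= /lupd; case: ifP => // /and4P[/eqP-> /eqP-> /eqP-> /eqP->].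
  by rewrite s'y.
by move=> h _ k; exact: h.
Qed.

Lemma restr_gens C (K : {group 'S_n}) : stable H C ->
  (restr_perm C @* H \subset K)%g = all (fun g => restr_perm C g \in K) gens.
Proof.
move=> stC; have NC := stable_astabs stC.
have gH g : g \in gens -> g \in H by move=> gin; rewrite HE mem_gen // inE.
apply/idP/allP => [/subsetP sub g gin|h].
  by apply: sub; apply: mem_morphim; [exact: subsetP NC _ (gH _ gin) | exact: gH].
rewrite HE morphim_gen; last by apply: subset_trans NC; rewrite HE subset_gen.
rewrite gen_subG; apply/subsetP => _ /morphimP[g _ gin ->]; apply: h.
by rewrite inE in gin.
Qed.

Lemma add_orbit_spec s cl (i : 'I_n) : main_data s -> holds_cells s cl ->
  labelling H orb i cl -> lmem s vI 0 0 0 = i -> i \in psupp H -> orb i = i ->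
  exists cl', holds_cells (sem n m p_add_orbit s) cl' /\ labelling H orb i.+1 cl'.
Proof.
move=> [sg so _] sc lab si iH oi; rewrite /p_add_orbit !sem_seq.
have [h1 h2 h3 h4] := lab.
have [] := @for_store n m vY (SIf (EEq (get1 aOrb (var vY)) (var vI))
    (set1 aCell (var vY) (var vI)) SSkip) s aCell 0 0 id
  (fun y => if orb y == i then i : nat else cl y) (@inj_id _) isT.
  move=> y s' fr un sy b i' j' k' bk.
  have E : eval n m s' (EEq (get1 aOrb (var vY)) (var vI)) = (orb y == i).
    by rewrite /= sy (fr vI) // (fr aOrb) // so si val_eqE.
  case: ifP E => e E; first by rewrite sem_ifT ?E //= sy (fr vI) // si.
  rewrite sem_ifF //= /lupd; case: ifP => // /and4P[/eqP-> /eqP-> /eqP-> /eqP->].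
  by rewrite un.
set s1 := sem n m _ s => c1 f1.
pose D := domain cl :|: orbit 'P H i.
have OE y : (y \in orbit 'P H i) = (orb y == i) by rewrite (mem_orbit_eq orb_in) // oi.
have stD : stable H D.
  apply: stableU; last exact: stable_orbit.
  by rewrite domainE; apply: stable_bigcup => c _; case: (h3 c).
have sg1 : holds_gens gens s1 by move=> x xm k; rewrite f1 // sg.
have dc : decides gens s1 (EEq (EEq (get1 aCell (var vK)) EPoints) zero) D.
  move=> s' k sk e /=; rewrite sk e // c1 !inE OE orbC.
  case: (eqVneq (orb k) i) => _ /=.
    by rewrite (ltn_eqF (ltn_ord i)).
  rewrite [RHS]ltn_neqAle h2 andbT.
  by case: (cl k == n).
have [tb [st2 tr tbP]] := build_spec n0 HE stD sg1 dc.
set s2 := sem n m (p_build _) s1 in st2 *.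
have fr2 a x y z : a \in [:: aGen; aCell; vI] -> lmem s2 a x y z = lmem s1 a x y z.
  by move=> ain; apply: sem_frame; move: ain; rewrite !inE => /or3P[]/eqP->.
pose ok (c : nat) :=
  all (fun g => restr_perm (cell cl c) g \in (restr_perm D @* H)%g) gens.
have okP (c : 'I_n) : reflect (separable H D (cell cl c)) (ok c).
  have [stc _] := h3 c.
  have cD : cell cl c \subset D.
    by apply/subsetP => x; rewrite !inE => /eqP->; rewrite ltn_ord.
  apply: (iffP idP) => [h|/(separableE stD stc cD)].
    by apply/(separableE stD stc cD); rewrite (restr_gens _ stc).
  by rewrite (restr_gens _ stc).
(* The labels once the cells below [c] have been tested; for [c = n] this is the relabelling of
   [labelling_step]. *)
pose lb (c : nat) y := if orb y == i then i : nat else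
  if (cl y < c) && ~~ ok (cl y) then i : nat else cl y.
have nocl y : cl y != i.
  apply/negP => /eqP e; have := h1 i.
  by rewrite (h4 y i e) ltn_ord oi ltnn andbF.
have notO y : cl y < n -> orb y != i.
  by rewrite h1 => /andP[_ lt]; rewrite -val_eqE ltn_eqF.
exists (lb n); split; last exact: labelling_step okP _.
pose P c s' := [/\ holds_gens gens s', holds_table s' tb, lmem s' vI 0 0 0 = i &
  holds_cells s' (lb c)].
have [] : P n (sem n m (SFor vC EPoints (SSeq p_test_cell p_relabel)) s2); last by [].
apply: for_points.
  split=> //.
  - by move=> x xm k; rewrite fr2 // sg1.
  - by rewrite fr2 // f1.
  - by move=> k; rewrite fr2 // c1.
move=> c s3 [sg3 st3 i3 c3]; set s4 := lset s3 vC 0 0 0 c; rewrite sem_seq.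
have sg4 : holds_gens gens s4 by [].
have st4 : holds_table s4 tb by exact: holds_table_lset.
have c4 : holds_cells s4 (lb c) by [].
split.
- by move=> x xm k; rewrite !sem_frame // sg4.
- by do 2!apply: holds_table_sem => //.
- by rewrite !sem_frame.
set s5 := sem n m p_test_cell s4.
have c5 : holds_cells s5 (lb c) by move=> k; rewrite sem_frame.
have v5 : lmem s5 vC 0 0 0 = c by rewrite sem_frame.
have i5 : lmem s5 vI 0 0 0 = i by rewrite sem_frame.
(* The cell with label [i] is the one being assembled. Its test may go either way: relabelling it by
   [i] changes nothing. *)
case: (eqVneq c i) => [ci|ci].
  have lbE y : lb c.+1 y = lb c y.
    rewrite /lb ltnS leq_eqVlt ci (negPf (nocl y)).
    by [].
  rewrite /p_relabel => y; rewrite lbE.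
  case: (eqVneq (lmem s5 vAll 0 0 0) 0) => h; last by rewrite sem_ifT.
  rewrite (relabel_spec (b := false) c5 v5 i5 h) /= ci.
  by case: eqP.
have [stc _] := h3 c.
(* Relabelling only moves points to label [i], so a cell is still intact when its turn comes. *)
have cellE : cell cl c = [set x | lb c x == c].
  apply/setP => x; rewrite !inE /lb.
  have ic : (i == c :> nat) = false by rewrite val_eqE eq_sym (negPf ci).
  case: (eqVneq (orb x) i) => [e|_].
    rewrite ic; apply/negP => /eqP e'; have := notO x.
    by rewrite e' ltn_ord e eqxx => /(_ isT).
  by case: ifP => // /andP[lt _]; rewrite ic ltn_eqF.
have ok5 : lmem s5 vAll 0 0 0 = ok c.
  rewrite (test_cell_spec HE stc sg4 tr st4 (erefl : lmem s4 vC 0 0 0 = c) c4 cellE).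
  by congr nat_of_bool; apply: eq_all => g; exact: tbP.
move=> y; rewrite (relabel_spec c5 v5 i5 ok5) /lb.
have ic : (i == c :> nat) = false by rewrite val_eqE eq_sym (negPf ci).
case: (eqVneq (orb y) i) => [_|_]; first by rewrite ic andbF.
rewrite ltnS [cl y <= c]leq_eqVlt; case: (ltngtP (cl y) c) => lt /=.
- by case: (ok (cl y)) => /=; rewrite ?ic ?andbF // ltn_eqF ?andbF.
- by rewrite gtn_eqF ?andbF.
- by rewrite lt eqxx andbT.
Qed.

Lemma main_spec s : main_data s -> exists cl,
  [/\ main_data (sem n m p_main s), holds_cells (sem n m p_main s) cl &
      labelling H orb n cl].
Proof.
move=> sd; rewrite /p_main sem_seq.
have [] := @for_store n m vK (set1 aCell (var vK) EPoints) s aCell 0 0 id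
  (fun=> n) (@inj_id _) isT.
  by move=> i s' fr un si b i' j' k' bk /=; rewrite si.
set s1 := sem n m _ s => c1 f1.
pose P i s' := main_data s' /\ exists cl, holds_cells s' cl /\ labelling H orb i cl.
have [] : P n (sem n m (SFor vI EPoints p_step) s1); last first.
  by move=> h [cl [hc lab]]; exists cl.
apply: for_points.
  split; last by exists (fun=> n); split=> //; exact: labelling0.
  by apply: main_data_eq sd => a i j k; rewrite !inE => /or3P[]/eqP->; exact: f1.
move=> i s2 [sd2 [cl [c2 lab]]]; set s3 := lset s2 vI 0 0 0 i.
have sd3 : main_data s3.
  by apply: main_data_eq sd2 => a x y z; rewrite !inE => /or3P[]/eqP->.
split.
  apply: main_data_eq sd3 => a x y z; rewrite !inE => /or3P[]/eqP->;
  exact: sem_frame.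
have [_ so3 sm3] := sd3; rewrite /p_step.
have mE : eval n m s3 (get1 aMoved (var vI)) = lmem s3 aMoved 0 0 i by [].
case: (boolP (i \in psupp H)) => iH; last first.
  rewrite sem_ifF; last by move: iH; rewrite -sm3 negbK => /eqP.
  by exists cl; split=> //; apply: labelling_skip => //; rewrite (negPf iH).
rewrite sem_ifT; last by rewrite mE sm3.
have oE : eval n m s3 (EEq (get1 aOrb (var vI)) (var vI)) = (orb i == i).
  by rewrite -val_eqE /= -so3.
case: (eqVneq (orb i) i) => oi; last first.
  rewrite sem_ifF; last by rewrite oE (negPf oi).
  by exists cl; split=> //; apply: labelling_skip => //; rewrite (negPf oi) andbF.
rewrite sem_ifT; last by rewrite oE oi eqxx.
exact: (add_orbit_spec (cl := cl)).
Qed.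

End Main.

(** * Output of nested lists *)

(** A list is preceded by its length, hence a separate counting pass. The count is written before
    the bodies run, so nested lists can share one counter. *)
Definition p_list (v : nat) (c1 c2 : expr) (body : stmt) : stmt :=
  SSeq (setv vCnt zero) (SSeq
    (SFor v EPoints (SIf c1 (SIf c2 (setv vCnt (ESucc (var vCnt))) SSkip) SSkip))
    (SSeq (SWrite (var vCnt))
       (SFor v EPoints (SIf c1 (SIf c2 body SSkip) SSkip)))).

Definition p_write_points : stmt :=
  p_list vY (EEq (get1 aOrb (var vY)) (var vI)) one (SWrite (var vY)).

Definition p_write_orbits : stmt :=
  p_list vI (EEq (get1 aCell (var vI)) (var vC))
    (EEq (get1 aOrb (var vI)) (var vI)) p_write_points.

Definition p_write : stmt :=
  p_list vC (EEq (get1 aCell (var vC)) (var vC)) one p_write_orbits.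

Section Output.
Variables (n m : nat).
Implicit Types (s : lstate).

Lemma take_enum_ord (k : 'I_n) :
  take k.+1 (enum 'I_n) = rcons (take k (enum 'I_n)) k.
Proof. by rewrite (take_nth k) ?size_enum_ord // nth_ord_enum. Qed.

(** [J] is what the body and the conditions need to know about the memory. *)
Lemma list_spec (J : (nat -> nat -> nat -> nat -> nat) -> Prop) v c1 c2 body
    (P : pred 'I_n) (f : 'I_n -> seq nat) s :
  v != vCnt ->
  (forall f x, J f -> J (lupd f v 0 0 0 x)) ->
  (forall f x, J f -> J (lupd f vCnt 0 0 0 x)) ->
  (forall s (i : 'I_n), J (lmem s) -> lmem s v 0 0 0 = i ->
     (eval n m s c1 != 0) && (eval n m s c2 != 0) = P i) ->
  (forall s (i : 'I_n), J (lmem s) -> lmem s v 0 0 0 = i -> P i ->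
     J (lmem (sem n m body s)) /\ lout (sem n m body s) = lout s ++ f i) ->
  J (lmem s) ->
  J (lmem (sem n m (p_list v c1 c2 body) s)) /\
  lout (sem n m (p_list v c1 c2 body) s) =
    lout s ++ encode_seq f [seq i <- enum 'I_n | P i].
Proof.
move=> vc Jv Jc cond bodyP sJ; rewrite /p_list !sem_seq.
set s1 := sem n m (setv vCnt zero) s.
have s1J : J (lmem s1) := Jc (lmem s) 0 sJ.
have guard b s' (i : 'I_n) : J (lmem s') -> lmem s' v 0 0 0 = i ->
    sem n m (SIf c1 (SIf c2 b SSkip) SSkip) s' = if P i then sem n m b s' else s'.
  move=> s'J s'i; rewrite -(cond s' i s'J s'i) /=.
  by case: ifP => //= _; case: ifP.
pose A k s' := [/\ J (lmem s'), lout s' = lout s &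
  lmem s' vCnt 0 0 0 = count P (take k (enum 'I_n))].
set cc := SFor v EPoints (SIf c1 (SIf c2 (setv vCnt _) SSkip) SSkip).
have [s2J s2o s2c] : A n (sem n m cc s1).
  apply: for_points; first by rewrite /A take0.
  move=> i s' [s'J s'o s'c]; set s'' := lset s' v 0 0 0 i.
  have s''J : J (lmem s'') by apply: (Jv (lmem s')).
  have s''c : lmem s'' vCnt 0 0 0 = count P (take i (enum 'I_n)).
    by rewrite -s'c /= /lupd eq_sym (negPf vc).
  rewrite (guard _ s'' i) //; last by rewrite /= /lupd !eqxx.
  rewrite /A take_enum_ord -cats1 count_cat /= addn0.
  case: (P i); last by rewrite addn0.
  split=> //; first by apply: (Jc (lmem s'')).
  (* Fewer than [n] points have been counted, so the clamp in [ESucc] is not reached. *)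
  have lt : (lmem s'' vCnt 0 0 0).+1 < radix n m.
    rewrite s''c ltnS; apply: leq_ltn_trans (count_size _ _) _.
    rewrite size_take size_enum_ord ltn_ord.
    by apply: leq_trans (ltn_ord i) _; lia.
  have e : eval n m s'' (ESucc (var vCnt)) = (lmem s'' vCnt 0 0 0).+1.
    by move: lt => /= ->.
  by rewrite addn1 -s''c; exact: e.
set s3 := sem n m (SWrite _) _.
have s3o : lout s3 = rcons (lout s) (size [seq i <- enum 'I_n | P i]).
  by rewrite /= s2o s2c take_oversize ?size_enum_ord // size_filter.
pose B k s' := J (lmem s') /\ lout s' = lout s3 ++
  flatten [seq f i | i <- [seq i <- take k (enum 'I_n) | P i]].
have [] : B n (sem n m (SFor v EPoints (SIf c1 (SIf c2 body SSkip) SSkip)) s3).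
  apply: for_points; first by split; rewrite ?take0 ?cats0.
  move=> i s' [s'J s'o]; set s'' := lset s' v 0 0 0 i.
  have s''J : J (lmem s'') by apply: (Jv (lmem s')).
  have s''i : lmem s'' v 0 0 0 = i by rewrite /= /lupd !eqxx.
  rewrite (guard _ s'' i) // /B take_enum_ord filter_rcons.
  case: ifP => Pi //; have [h1 h2] := bodyP s'' i s''J s''i Pi.
  by split=> //; rewrite h2 map_rcons flatten_rcons catA -s'o.
move=> h1 h2; split=> //.
by rewrite h2 s3o take_oversize ?size_enum_ord // /encode_seq -cats1 -catA.
Qed.

End Output.

Section WriteSpec.
Variables (n m : nat) (H : {group 'S_n}) (orb : 'I_n -> 'I_n) (cl : 'I_n -> nat).
Hypothesis orb_in : forall x, orb x \in orbit 'P H x.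
Hypothesis orb_inv : forall h x, h \in H -> orb (h x) = orb x.
Implicit Types (s : lstate).

Let knows (f : nat -> nat -> nat -> nat -> nat) : Prop :=
  (forall k : 'I_n, f aOrb 0 0 k = orb k) /\ (forall k : 'I_n, f aCell 0 0 k = cl k).

Let knowsU f v i j k x :
  v \notin [:: aOrb; aCell] -> knows f -> knows (lupd f v i j k x).
Proof.
rewrite !inE negb_or => /andP[/negPf h1 /negPf h2] [k1 k2].
by split=> y; rewrite /lupd eq_sym ?h1 ?h2 /= ?k1 ?k2.
Qed.

Lemma encode_seq_map (T U : Type) (g : T -> U) (enc : U -> seq nat) (r : seq T) :
  encode_seq enc [seq g x | x <- r] = encode_seq (fun x => enc (g x)) r.
Proof. by rewrite /encode_seq size_map -map_comp. Qed.

Lemma write_points_spec s (i c : 'I_n) : knows (lmem s) ->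
  lmem s vC 0 0 0 = c -> lmem s vI 0 0 0 = i -> orb i = i ->
  knows (lmem (sem n m p_write_points s)) /\
  lout (sem n m p_write_points s) = lout s ++ encode_orbit (orbit 'P H i).
Proof.
move=> ks sc si oi.
have [||||||[k' _] o'] := @list_spec n m (fun f => knows f /\ f vI 0 0 0 = i)
  vY (EEq (get1 aOrb (var vY)) (var vI)) one (SWrite (var vY))
  (fun y => orb y == i) (fun y => [:: val y]) s.
- by [].
- by move=> f x [kf fi]; split=> //; exact: knowsU.
- by move=> f x [kf fi]; split=> //; exact: knowsU.
- move=> s' y [[k1 _] ki] sy; rewrite /= sy k1 ki val_eqE andbT.
  by case: (orb y == i).
- by move=> s' y [k1 ki] sy _; split=> //=; rewrite sy cats1.
- by split.
split=> //; rewrite o' /encode_orbit; congr (_ ++ encode_seq _ _).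
(* The enumeration of a set filters that of all points, so it has the order in which the loop
   writes. *)
rewrite /(enum (orbit _ _ _)) /= {1}enumT; apply: eq_filter => y.
by have := mem_orbit_eq orb_in orb_inv i y; rewrite oi => <-.
Qed.

Lemma write_orbits_spec s (c : 'I_n) : knows (lmem s) -> lmem s vC 0 0 0 = c ->
  [/\ knows (lmem (sem n m p_write_orbits s)),
      lmem (sem n m p_write_orbits s) vC 0 0 0 = c &
      lout (sem n m p_write_orbits s) = lout s ++
        encode_seq (@encode_orbit n) [seq orbit 'P H i | i <- orbit_reps orb cl c]].
Proof.
move=> ks sc.
have [||||||[k' c'] o'] := @list_spec n m (fun f => knows f /\ f vC 0 0 0 = c)
  vI (EEq (get1 aCell (var vI)) (var vC)) (EEq (get1 aOrb (var vI)) (var vI))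
  p_write_points (fun i => (cl i == c) && (orb i == i))
  (fun i => encode_orbit (orbit 'P H i)) s.
- by [].
- by move=> f x [kf fc]; split=> //; exact: knowsU.
- by move=> f x [kf fc]; split=> //; exact: knowsU.
- move=> s' i [[k1 k2] kc] si; rewrite /= si k1 k2 kc val_eqE.
  by case: (cl i == c); case: (orb i == i).
- move=> s' i [k1 kc] si /andP[_ /eqP oi].
  have [h1 h2] := write_points_spec k1 kc si oi.
  by split=> //; split=> //; rewrite sem_frame.
- by split.
by split=> //; rewrite o' encode_seq_map.
Qed.

Lemma write_spec s : knows (lmem s) ->
  lout (sem n m p_write s) = lout s ++ encode_output (partition_list H orb cl).
Proof.
move=> ks.
have [||||||_ o'] := @list_spec n m knows
  vC (EEq (get1 aCell (var vC)) (var vC)) one p_write_orbits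
  (fun c => cl c == c)
  (fun c => encode_seq (@encode_orbit n)
     [seq orbit 'P H i | i <- orbit_reps orb cl c]) s.
- by [].
- by move=> f x; exact: knowsU.
- by move=> f x; exact: knowsU.
- move=> s' c [_ k2] sc; rewrite /= sc k2 andbT.
  by case: (cl c == c).
- by move=> s' c k1 sc _; have [] := write_orbits_spec k1 sc.
- by [].
by rewrite o' /encode_output encode_seq_map.
Qed.

End WriteSpec.

(** * The complete algorithm *)

Definition p_decompose : stmt :=
  SSeq p_read (SSeq p_moved (SSeq p_orbits (SSeq p_main p_write))).

Lemma decompose_spec n (gens : seq 'S_n) (H : {group 'S_n}) : 0 < n ->
  H :=: <<[set g in gens]>>%g ->
  exists Cs : seq (seq {set 'I_n}),
    [/\ lout (sem n (size gens) p_decompose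
          (linit (flatten [seq encode_perm g | g <- gens]))) = encode_output Cs,
        lists_orbit_partition H Cs & finest_ddp_decomposition H (factors H Cs)].
Proof.
move=> n0 HE; set m := size gens; rewrite /p_decompose 4!sem_seq.
set s0 := linit _; set s1 := sem n m p_read s0.
have g1 : holds_gens gens s1 by exact: read_spec.
set s2 := sem n m p_moved s1.
have g2 : holds_gens gens s2 by move=> x xm k; rewrite sem_frame // g1.
have m2 : forall k : 'I_n, (lmem s2 aMoved 0 0 k != 0) = (k \in psupp H).
  by apply: moved_spec => // k; rewrite sem_frame.
have [orb [o3 [oin oinv]]] := orbits_spec HE g2.
set s3 := sem n m p_orbits s2 in o3 *.
have d3 : main_data gens H orb s3.
  split=> //; first by move=> x xm k; rewrite sem_frame // g2.
  by move=> k; rewrite sem_frame // m2.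
have [cl [[_ o4 _] c4 lab]] := main_spec n0 HE oin oinv d3.
exists (partition_list H orb cl); split.
- rewrite (@write_spec _ _ H orb cl) //.
  by rewrite sem_silent // /s3 sem_silent // /s2 sem_silent // /s1 sem_silent.
- exact: partition_list_ok.
- exact: partition_list_finest.
Qed.

Lemma trivial_decomposition n (H : {group 'S_n}) : H :=: 1%g ->
  lists_orbit_partition H [::] /\ finest_ddp_decomposition H (factors H [::]).
Proof.
move=> H1; split; first split=> // O.
  rewrite in_nil inE; apply/esym/andP => -[/imsetP[x _ ->]].
  have -> : orbit 'P H x = [set x].
    apply/setP => y; rewrite inE; apply/orbitP/eqP => [[h]|->].
      by rewrite H1 inE => /eqP-> <-; rewrite /= apermE perm1.
    by exists 1%g; rewrite ?group1 //= apermE perm1.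
  by rewrite cards1.
by split=> //; split=> //; rewrite big_nil H1.
Qed.

Theorem theorem1p2 :
  exists (c : prog) (p : {poly nat}),
    forall (n : nat) (X : {set 'S_n}) (gens : seq 'S_n),
      perm_eq gens (enum X) ->
      exists (t : nat) (Cs : seq (seq {set 'I_n})),
        [/\ computes_in c (encode_input gens) t (encode_output Cs),
            t <= (p.[(n * #|X|)%N])%R,
            lists_orbit_partition <<X>>%G Cs
          & finest_ddp_decomposition <<X>>%G (factors <<X>>%G Cs)].
Proof.
have [c [p cp]] := program_compiles p_decompose.
exists c, p => n X gens gX.
have sz : size gens = #|X| by rewrite (perm_size gX) cardE.
have XE : X = [set g in gens].
  by apply/setP => g; rewrite inE (perm_mem gX) mem_enum.
have [t [ct tp]] := cp n (size gens) (flatten [seq encode_perm g | g <- gens]).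
rewrite sz in tp; exists t.
(* With no points or no generators the group is trivial, and the output [[:: 0]] encodes the empty
   partition. *)
case: ifP ct => [z|/norP[n0 m0]] ct.
  exists [::]; have [] := @trivial_decomposition n <<X>>%G; last by split.
  case/orP: z => /eqP z.
    apply/trivgP/subsetP => h _; rewrite inE; apply/eqP/permP => x.
    by case: x => x' lt; exfalso; rewrite z in lt.
  have -> : X = set0 by apply/eqP; rewrite -cards_eq0 -sz z.
  exact: gen0.
have [||Cs [outE Csl Csf]] := @decompose_spec n gens <<X>>%G.
- by rewrite lt0n.
- by rewrite /= -XE.
by exists Cs; split=> //; rewrite -outE.
Qed.
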